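(* Let $K$ be a field of characteristic zero and let $R$ be an integral domain which is a regular ring and the localisation of a finitely generated $K$-algebra, and which has a maximal ideal $\mathfrak m$ such that $R/\mathfrak m$ is a finite extension of $K$. Then the category $\mathbf{ICon}(R/K)$ (respectively $\mathbf{ICon}_{\mathbf{int}}(R/K)$) of finitely generated $R$-modules with iterative connection (respectively integrable iterative connection) and the category of finitely generated $R$-modules with connection (respectively integrable connection) are equivalent.
   Context: Higher derivations. $\mathrm{HD}_K(R)$ is the set of $K$-algebra homomorphisms $\psi:R\to R[[T]]$, $\psi(r)=\sum_k\psi^{(k)}(r)T^k$, with $\psi^{(0)}=\mathrm{id}$. Put $\psi[[T]](\sum a_iT^i)=\sum\psi(a_i)T^i$ and $\psi_1\psi_2:=\psi_1[[T]]\circ\psi_2$. Algebra of higher differentials. $\hat\Omega=\hat\Omega_{R/K}=\prod_k\hat\Omega_k$ is the completion by degree of the graded commutative $R$-algebra generated by symbols $d^{(k)}r$ ($k\ge1$, $r\in R$), of degree $k$, modulo $d^{(k)}(r+s)=d^{(k)}r+d^{(k)}s$, $d^{(k)}a=0$ for $a\in K$, $d^{(k)}(rs)=\sum_{i=0}^kd^{(i)}r\,d^{(k-i)}s$ (with $d^{(0)}r:=r$). Set $d_R(r)=\sum_kd^{(k)}r$, and let $d_{\hat\Omega}$ be the continuous $K$-algebra automorphism of $\hat\Omega$ with $d_{\hat\Omega}(d^{(i)}r)=\sum_{j\ge0}\binom{i+j}{j}d^{(i+j)}r$. For $\psi\in\mathrm{HD}_K(R)$, $\tilde\psi:\hat\Omega\to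 R[[T]]$ is the continuous $R$-algebra homomorphism with $d^{(k)}r\mapsto\psi^{(k)}(r)T^k$. Connections. $\hat\Omega\otimes_RM$ denotes $\prod_k\hat\Omega_k\otimes_RM$. A higher connection on a finitely generated $R$-module $M$ is an additive map $\nabla=\sum_k\nabla^{(k)}:M\to\hat\Omega\otimes_RM$ with $\nabla(rm)=d_R(r)\nabla(m)$ and $\nabla^{(0)}=\mathrm{id}_M$. Put ${}_{\hat\Omega}\nabla(\omega\otimes x)=d_{\hat\Omega}(\omega)\nabla(x)$, with ${}_{\hat\Omega}\nabla^{(i)}$ the part raising degrees by $i$. $\nabla$ is iterative if ${}_{\hat\Omega}\nabla^{(i)}\circ{}_{\hat\Omega}\nabla^{(j)}=\binom{i+j}{i}{}_{\hat\Omega}\nabla^{(i+j)}$ for all $i,j\ge0$. Put $\nabla_\psi=(\tilde\psi\otimes\mathrm{id}_M)\circ\nabla:M\to M[[T]]$ and $\nabla_{\psi_1}\nabla_{\psi_2}:=\nabla_{\psi_1}[[T]]\circ\nabla_{\psi_2}$, where $\nabla_\psi[[T]](\sum m_iT^i)=\sum\nabla_\psi(m_i)T^i$. An iterative connection is integrable if $\nabla_{\psi_1\psi_2}=\nabla_{\psi_1}\nabla_{\psi_2}$ for all $\psi_1,\psi_2\in\mathrm{HD}_K(R)$. Morphisms $(M_1,\nabla_1)\to(M_2,\nabla_2)$ are the $R$-linear maps $f$ with $\nabla_2\circ f=(\mathrm{id}_{\hat\Omega}\otimes f)\circ\nabla_1$. An (ordinary) connection on $M$ is a $K$-linear map $\nabla:M\to\Omega_{R/K}\otimes_RM$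 satisfying the Leibniz rule; it is integrable if $[\nabla_{\partial_1},\nabla_{\partial_2}]=\nabla_{[\partial_1,\partial_2]}$ for all $K$-derivations $\partial_1,\partial_2$ of $R$. Morphisms of modules with connection are the $R$-linear maps commuting with the connections. *)

(* Defs.v *)
From HB Require Import structures.
From mathcomp Require Import all_boot all_algebra all_field generic_quotient.
From mathcomp Require Import zify ring boolp.

Set Implicit Arguments.
Unset Strict Implicit.
Unset Printing Implicit Defensive.
Import GRing.Theory.
Local Open Scope ring_scope.

Record equivalence_on (T : Type) := EquivalenceOn {
  eqv :> T -> T -> Prop;
  eqv_refl : forall x, eqv x x;
  eqv_sym : forall x y, eqv x y -> eqv y x;
  eqv_trans : forall x y z, eqv x y -> eqv y z -> eqv x z }.

Section Quotient.
Variables (T : Type) (e : equivalence_on T).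

Definition eqvb : rel {classic T} := fun x y => `[< e x y >].

Lemma eqvb_refl : reflexive eqvb.
Proof. by move=> x; apply/asboolP/eqv_refl. Qed.

Lemma eqvb_sym : symmetric eqvb.
Proof. by move=> x y; apply/asboolP/asboolP; apply: eqv_sym. Qed.

Lemma eqvb_trans : transitive eqvb.
Proof.
by move=> y x z /asboolP xy /asboolP yz; apply/asboolP; apply: eqv_trans xy yz.
Qed.

Definition eqvb_equiv := EquivRel eqvb eqvb_refl eqvb_sym eqvb_trans.

Definition quot : Type := {eq_quot eqvb_equiv}%qT.

Definition cls (t : T) : quot := (\pi_({eq_quot eqvb_equiv}) t)%qT.
Definition rep (x : quot) : T := repr x.

Lemma repK x : cls (rep x) = x. Proof. exact: reprK. Qed.

Lemma cls_eq t u : e t u -> cls t = cls u.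
Proof. by move=> tu; apply/eqmodP/asboolP. Qed.

Lemma cls_inj t u : cls t = cls u -> e t u.
Proof. by move=> /eqmodP /asboolP. Qed.

Lemma rep_cls t : e (rep (cls t)) t. Proof. by apply: cls_inj; rewrite repK. Qed.

Lemma clsP x : exists t, x = cls t. Proof. by exists (rep x); rewrite repK. Qed.

End Quotient.

Section TriangularSums.
Variable V : zmodType.

Lemma sum_triangle (n : nat) (F : nat -> nat -> nat -> V) :
  \sum_(i < n.+1) \sum_(j < i.+1) F j (i - j)%N (n - i)%N =
  \sum_(j < n.+1) \sum_(k < (n - j).+1) F j k (n - j - k)%N.
Proof.
transitivity (\sum_(i < n.+1) \sum_(j < n.+1 | (j < i.+1)%N)
    F j (i - j)%N (n - i)%N).
  apply: eq_bigr => i _.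
  by rewrite (big_ord_widen _ (fun j : nat => F j (i - j)%N (n - i)%N) (ltn_ord i)).
rewrite (exchange_big_dep predT) //=; apply: eq_bigr => j _.
rewrite -(big_mkord (fun i : nat => (j < i.+1)%N)
   (fun i => F j (i - j)%N (n - i)%N)).
rewrite -(big_mkord predT (fun k => F j k (n - j - k)%N)).
rewrite (big_cat_nat (n := j)) //=; last by rewrite ltnW // ltnS -ltnS.
rewrite big_nat_cond big_pred0 ?add0r; last first.
  by move=> i; rewrite ltnS; case: (leqP j i); rewrite ?andbF // andbT.
rewrite -{1}[j : nat]add0n big_addn subSn; last by rewrite -ltnS.
rewrite big_nat_cond [RHS]big_nat_cond.
apply: eq_big => i; first by rewrite [X in _ && X]ltnS leq_addl.
by move=> _; rewrite addnK subnDA subnAC.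
Qed.

Lemma sum_triangle_sym (n : nat) (F : nat -> nat -> nat -> V) :
  \sum_(j < n.+1) \sum_(k < (n - j).+1) F j k (n - j - k)%N =
  \sum_(k < n.+1) \sum_(j < (n - k).+1) F j k (n - k - j)%N.
Proof.
rewrite -(sum_triangle n F) -(sum_triangle n (fun k j => F j k)).
apply: eq_bigr => i _; rewrite (reindex_inj rev_ord_inj) /=.
by apply: eq_bigr => j _; rewrite subSS subKn // -ltnS.
Qed.

End TriangularSums.

Definition fps (A : Type) := nat -> A.

HB.instance Definition _ (A : Type) := gen_eqMixin (fps A).
HB.instance Definition _ (A : Type) := gen_choiceMixin (fps A).

Section Fps.
Variable A : comNzRingType.
Implicit Types f g h : fps A.

Definition fpsC (a : A) : fps A := fun n => if n == 0 then a else 0.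
Definition fps_add f g : fps A := fun n => f n + g n.
Definition fps_opp f : fps A := fun n => - f n.
Definition fps_mul f g : fps A := fun n => \sum_(i < n.+1) f i * g (n - i)%N.

Lemma fps_addA : associative fps_add.
Proof. by move=> f g h; apply/funext => n; apply: addrA. Qed.
Lemma fps_addC : commutative fps_add.
Proof. by move=> f g; apply/funext => n; apply: addrC. Qed.
Lemma fps_add0 : left_id (fpsC 0) fps_add.
Proof.
by move=> f; apply/funext => n; rewrite /fps_add /fpsC; case: (n == 0); rewrite add0r.
Qed.
Lemma fps_addN : left_inverse (fpsC 0) fps_opp fps_add.
Proof.
move=> f; apply/funext => n; rewrite /fps_add /fpsC /fps_opp addNr.
by case: (n == 0).
Qed.
HB.instance Definition _ :=
  GRing.isZmodule.Build (fps A) fps_addA fps_addC fps_add0 fps_addN.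

Lemma fps_mulC : commutative fps_mul.
Proof.
move=> f g; apply/funext => n; rewrite /fps_mul (reindex_inj rev_ord_inj) /=.
by apply: eq_bigr => i _; rewrite subSS mulrC subKn // -ltnS.
Qed.

Lemma fps_mulA : associative fps_mul.
Proof.
move=> f g h; apply/funext => n; rewrite /fps_mul; apply/esym.
transitivity (\sum_(i < n.+1) \sum_(j < i.+1)
   (fun a b c => f a * (g b * h c)) j (i - j)%N (n - i)%N).
  by apply: eq_bigr => i _; rewrite mulr_suml; apply: eq_bigr => j _; rewrite mulrA.
rewrite (sum_triangle n (fun a b c => f a * (g b * h c))).
by apply: eq_bigr => i _; rewrite mulr_sumr.
Qed.

Lemma fpsC_mul a f n : fps_mul (fpsC a) f n = a * f n.
Proof.
rewrite /fps_mul big_ord_recl subn0 /fpsC /= big1 ?addr0 // => i _.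
by rewrite mul0r.
Qed.

Lemma fps_mul1 : left_id (fpsC 1) fps_mul.
Proof. by move=> f; apply/funext => n; rewrite fpsC_mul mul1r. Qed.

Lemma fps_mulDl : left_distributive fps_mul fps_add.
Proof.
move=> f g h; apply/funext => n; rewrite /fps_mul /fps_add -big_split /=.
by apply: eq_bigr => i _; rewrite mulrDl.
Qed.

Lemma fps_1neq0 : fpsC 1 != fpsC 0.
Proof.
by apply/eqP => /(congr1 (fun f : fps A => f 0)) /eqP; rewrite /fpsC /= oner_eq0.
Qed.

HB.instance Definition _ := GRing.Zmodule_isComNzRing.Build (fps A)
  fps_mulA fps_mulC fps_mul1 fps_mulDl fps_1neq0.

Lemma fps0E n : (0 : fps A) n = 0.
Proof. by rewrite /GRing.zero /= /fpsC; case: (n == 0). Qed.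
Lemma fpsDE f g n : (f + g) n = f n + g n. Proof. by []. Qed.
Lemma fpsBE f g n : (f - g) n = f n - g n. Proof. by []. Qed.
Lemma fpsME f g n : (f * g) n = \sum_(i < n.+1) f i * g (n - i)%N.
Proof. by []. Qed.
Lemma fps1E n : (1 : fps A) n = if n == 0 then 1 else 0. Proof. by []. Qed.
Lemma fps_sumE I (r : seq I) (P : pred I) (F : I -> fps A) n :
  (\sum_(i <- r | P i) F i) n = \sum_(i <- r | P i) F i n.
Proof. by elim/big_rec2: _ => [|i y1 y2 _ <-]; rewrite ?fps0E ?fpsDE. Qed.

(** [a T^k] *)
Definition fpsm (k : nat) (a : A) : fps A := fun n => if n == k then a else 0.

Lemma fpsm_mul i j a b : fpsm i a * fpsm j b = fpsm (i + j) (a * b).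
Proof.
apply/funext => n; rewrite fpsME /fpsm.
case: (leqP i n) => [le_in|lt_ni]; last first.
  rewrite big1; first by case: eqP => // E; rewrite E ltnNge leq_addr in lt_ni.
  move=> k _; case: eqP => [E|_]; last by rewrite mul0r.
  by have := ltn_ord k; rewrite E ltnS leqNgt lt_ni.
have lt_in : (i < n.+1)%N by [].
rewrite (bigD1 (Ordinal lt_in)) //= eqxx big1 ?addr0; last first.
  by move=> k; rewrite -val_eqE /= => /negPf ->; rewrite mul0r.
have ->: (n - i == j)%N = (n == i + j)%N by rewrite -(eqn_add2l i) subnKC.
by case: eqP => // _; rewrite mulr0.
Qed.

Lemma fpsm_add k a b : fpsm k (a + b) = fpsm k a + fpsm k b.
Proof. by apply/funext => n; rewrite fpsDE /fpsm; case: eqP; rewrite ?addr0. Qed.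

Lemma fpsm0 k : fpsm k 0 = 0.
Proof. by apply/funext => n; rewrite fps0E /fpsm; case: eqP. Qed.

Lemma fpsm_sum I (r : seq I) (P : pred I) (F : I -> A) k :
  fpsm k (\sum_(i <- r | P i) F i) = \sum_(i <- r | P i) fpsm k (F i).
Proof. by elim/big_rec2: _ => [|i y1 y2 _ <-]; rewrite ?fpsm0 ?fpsm_add. Qed.

End Fps.

Section HigherDifferentials.
Variables (K : fieldType) (R : comAlgType K).

(** Expressions in the symbols [d^(k) r]. The symbols with [k = 0] stand for the
    coefficients [r : R], so that [0] is [d^(0) 0] and [1] is [d^(0) 1]. *)
Inductive hdterm : Type :=
  | HGen of nat & R
  | HAdd of hdterm & hdterm
  | HOpp of hdterm
  | HMul of hdterm & hdterm.

Definition hdterm_sum (s : seq hdterm) := foldr HAdd (HGen 0 0) s.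

Inductive hdeq : hdterm -> hdterm -> Prop :=
  | hdeq_refl t : hdeq t t
  | hdeq_sym t u : hdeq t u -> hdeq u t
  | hdeq_trans t u v : hdeq t u -> hdeq u v -> hdeq t v
  | hdeq_add t t' u u' : hdeq t t' -> hdeq u u' -> hdeq (HAdd t u) (HAdd t' u')
  | hdeq_opp t t' : hdeq t t' -> hdeq (HOpp t) (HOpp t')
  | hdeq_mul t t' u u' : hdeq t t' -> hdeq u u' -> hdeq (HMul t u) (HMul t' u')
  | hdeq_addA t u v : hdeq (HAdd t (HAdd u v)) (HAdd (HAdd t u) v)
  | hdeq_addC t u : hdeq (HAdd t u) (HAdd u t)
  | hdeq_add0 t : hdeq (HAdd (HGen 0 0) t) t
  | hdeq_addN t : hdeq (HAdd (HOpp t) t) (HGen 0 0)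
  | hdeq_mulA t u v : hdeq (HMul t (HMul u v)) (HMul (HMul t u) v)
  | hdeq_mulC t u : hdeq (HMul t u) (HMul u t)
  | hdeq_mul1 t : hdeq (HMul (HGen 0 1) t) t
  | hdeq_mulDl t u v : hdeq (HMul (HAdd t u) v) (HAdd (HMul t v) (HMul u v))
  (* relations between the symbols; for [k = 0] the first and the third one say
     that [r |-> d^(0) r] is additive and multiplicative *)
  | hdeq_genD k r s : hdeq (HGen k (r + s)) (HAdd (HGen k r) (HGen k s))
  | hdeq_genK k (a : K) : (0 < k)%N -> hdeq (HGen k a%:A) (HGen 0 0)
  | hdeq_genM k r s : hdeq (HGen k (r * s))
      (hdterm_sum [seq HMul (HGen i r) (HGen (k - i) s) | i <- iota 0 k.+1]).

Definition hd_eqv := EquivalenceOn hdeq_refl hdeq_sym hdeq_trans.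

(** The graded algebra [Omega], before completion by degree. "Graded commutative"
    means graded and commutative, without signs. *)
Definition hdiff : Type := quot hd_eqv.

HB.instance Definition _ := gen_eqMixin hdiff.
HB.instance Definition _ := gen_choiceMixin hdiff.

Definition hd (k : nat) (r : R) : hdiff := cls hd_eqv (HGen k r).
Definition hd_add (x y : hdiff) : hdiff := cls hd_eqv (HAdd (rep x) (rep y)).
Definition hd_opp (x : hdiff) : hdiff := cls hd_eqv (HOpp (rep x)).
Definition hd_mul (x y : hdiff) : hdiff := cls hd_eqv (HMul (rep x) (rep y)).

Lemma hd_addE t u : hd_add (cls hd_eqv t) (cls hd_eqv u) = cls hd_eqv (HAdd t u).
Proof. by apply/cls_eq/hdeq_add; apply: (rep_cls hd_eqv). Qed.
Lemma hd_oppE t : hd_opp (cls hd_eqv t) = cls hd_eqv (HOpp t).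
Proof. by apply/cls_eq/hdeq_opp; apply: (rep_cls hd_eqv). Qed.
Lemma hd_mulE t u : hd_mul (cls hd_eqv t) (cls hd_eqv u) = cls hd_eqv (HMul t u).
Proof. by apply/cls_eq/hdeq_mul; apply: (rep_cls hd_eqv). Qed.

Lemma hd_addA : associative hd_add.
Proof.
move=> x y z; case: (clsP x) (clsP y) (clsP z) => t -> [u ->] [v ->].
by rewrite !hd_addE; apply/cls_eq/hdeq_addA.
Qed.
Lemma hd_addC : commutative hd_add.
Proof.
move=> x y; case: (clsP x) (clsP y) => t -> [u ->].
by rewrite !hd_addE; apply/cls_eq/hdeq_addC.
Qed.
Lemma hd_add0 : left_id (hd 0 0) hd_add.
Proof.
by move=> x; case: (clsP x) => t ->; rewrite hd_addE; apply/cls_eq/hdeq_add0.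
Qed.
Lemma hd_addN : left_inverse (hd 0 0) hd_opp hd_add.
Proof.
move=> x; case: (clsP x) => t ->; rewrite hd_oppE hd_addE.
exact/cls_eq/hdeq_addN.
Qed.
HB.instance Definition _ :=
  GRing.isZmodule.Build hdiff hd_addA hd_addC hd_add0 hd_addN.

Lemma hd_mulA : associative hd_mul.
Proof.
move=> x y z; case: (clsP x) (clsP y) (clsP z) => t -> [u ->] [v ->].
by rewrite !hd_mulE; apply/cls_eq/hdeq_mulA.
Qed.
Lemma hd_mulC : commutative hd_mul.
Proof.
move=> x y; case: (clsP x) (clsP y) => t -> [u ->].
by rewrite !hd_mulE; apply/cls_eq/hdeq_mulC.
Qed.
Lemma hd_mul1 : left_id (hd 0 1) hd_mul.
Proof.
by move=> x; case: (clsP x) => t ->; rewrite hd_mulE; apply/cls_eq/hdeq_mul1.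
Qed.
Lemma hd_mulDl : left_distributive hd_mul hd_add.
Proof.
move=> x y z; case: (clsP x) (clsP y) (clsP z) => t -> [u ->] [v ->].
by rewrite !(hd_addE, hd_mulE); apply/cls_eq/hdeq_mulDl.
Qed.

Fixpoint hdeval (B : comNzRingType) (g : nat -> R -> B) (t : hdterm) : B :=
  match t with
  | HGen k r => g k r
  | HAdd t u => hdeval g t + hdeval g u
  | HOpp t => - hdeval g t
  | HMul t u => hdeval g t * hdeval g u
  end.

Record hdcompat (B : comNzRingType) (g : nat -> R -> B) : Prop := HDCompat {
  hdcompat1 : g 0 1 = 1;
  hdcompatD : forall k r s, g k (r + s) = g k r + g k s;
  hdcompatK : forall k (a : K), (0 < k)%N -> g k a%:A = 0;
  hdcompatM : forall k r s, g k (r * s) = \sum_(i < k.+1) g i r * g (k - i)%N s }.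

Lemma hdcompat0 (B : comNzRingType) (g : nat -> R -> B) k :
  hdcompat g -> g k 0 = 0.
Proof. by move=> gP; apply: (addrI (g k 0)); rewrite -(hdcompatD gP) !addr0. Qed.

Lemma hdeval_sum (B : comNzRingType) (g : nat -> R -> B) (s : seq hdterm) :
  hdcompat g -> hdeval g (hdterm_sum s) = \sum_(t <- s) hdeval g t.
Proof.
move=> gP; elim: s => [|t s IHs] /=; first by rewrite big_nil (hdcompat0 _ gP).
by rewrite big_cons IHs.
Qed.

Lemma hdeval_eq (B : comNzRingType) (g : nat -> R -> B) t u :
  hdcompat g -> hdeq t u -> hdeval g t = hdeval g u.
Proof.
move=> gP; elim=> {t u}.
- by [].
- by move=> t u _ ->.
- by move=> t u v _ -> _ ->.
- by move=> t t' u u' _ /= -> _ ->.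
- by move=> t t' _ /= ->.
- by move=> t t' u u' _ /= -> _ ->.
- by move=> t u v; apply: addrA.
- by move=> t u; apply: addrC.
- by move=> t; rewrite /= (hdcompat0 _ gP) add0r.
- by move=> t; rewrite /= (hdcompat0 _ gP) addNr.
- by move=> t u v; apply: mulrA.
- by move=> t u; apply: mulrC.
- by move=> t; rewrite /= (hdcompat1 gP) mul1r.
- by move=> t u v; apply: mulrDl.
- by move=> k r s; apply: (hdcompatD gP).
- by move=> k a k_gt0; rewrite /= (hdcompatK gP) // (hdcompat0 _ gP).
- move=> k r s; rewrite hdeval_sum // big_map [LHS](hdcompatM gP).
  by rewrite -[iota 0 k.+1]/(index_iota 0 k.+1) big_mkord.
Qed.

Lemma hd_1neq0 : hd 0 1 != hd 0 0.
Proof.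
pose g k (r : R) : R := if k is 0 then r else 0.
have gP : hdcompat g.
  split=> //.
  - by case=> // k r s; rewrite addr0.
  - by case.
  - case=> [|k] r s; first by rewrite big_ord1.
    rewrite [LHS]/= big1 // => -[[|i] ?] _; last by rewrite mul0r.
    by rewrite mulr0.
apply/eqP => E; have /eqP := hdeval_eq gP (cls_inj E).
by rewrite /= oner_eq0.
Qed.

HB.instance Definition _ := GRing.Zmodule_isComNzRing.Build hdiff
  hd_mulA hd_mulC hd_mul1 hd_mulDl hd_1neq0.

Lemma hdD k r s : hd k (r + s) = hd k r + hd k s.
Proof. by rewrite [RHS]hd_addE; apply/cls_eq/hdeq_genD. Qed.

Lemma hd00 : hd 0 0 = 0. Proof. by []. Qed.
Lemma hd01 : hd 0 1 = 1. Proof. by []. Qed.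

Lemma hdK k (a : K) : (0 < k)%N -> hd k a%:A = 0.
Proof. by move=> k_gt0; apply/cls_eq/hdeq_genK. Qed.

Lemma cls_hdterm_sum (s : seq hdterm) :
  cls hd_eqv (hdterm_sum s) = \sum_(t <- s) (cls hd_eqv t : hdiff).
Proof. by elim: s => [|t s IHs]; rewrite ?big_nil // big_cons -IHs [RHS]hd_addE. Qed.

Lemma hdM k r s : hd k (r * s) = \sum_(i < k.+1) hd i r * hd (k - i) s.
Proof.
rewrite [LHS](@cls_eq _ hd_eqv _ _ (hdeq_genM k r s)) cls_hdterm_sum big_map.
rewrite -[iota 0 k.+1]/(index_iota 0 k.+1) big_mkord.
by apply: eq_bigr => i _; rewrite [RHS]hd_mulE.
Qed.

Lemma hd0M r s : hd 0 (r * s) = hd 0 r * hd 0 s.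
Proof. by rewrite hdM big_ord1. Qed.

Lemma hdiff_ind (P : hdiff -> Prop) :
    (forall k r, P (hd k r)) -> (forall x y, P x -> P y -> P (x + y)) ->
    (forall x, P x -> P (- x)) -> (forall x y, P x -> P y -> P (x * y)) ->
  forall x, P x.
Proof.
move=> Pgen Padd Popp Pmul x; case: (clsP x) => t ->.
elim: t => [k r|t Pt u Pu|t Pt|t Pt u Pu]; first exact: Pgen.
- by rewrite -hd_addE; apply: Padd.
- by rewrite -hd_oppE; apply: Popp.
- by rewrite -hd_mulE; apply: Pmul.
Qed.

Definition hd_scale (r : R) (x : hdiff) : hdiff := hd 0 r * x.

Lemma hd_scaleA r s x : hd_scale r (hd_scale s x) = hd_scale (r * s) x.
Proof. by rewrite /hd_scale hd0M mulrA. Qed.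
Lemma hd_scale1 : left_id 1 hd_scale.
Proof. by move=> x; rewrite /hd_scale hd01 mul1r. Qed.
Lemma hd_scaleDr : right_distributive hd_scale +%R.
Proof. by move=> r x y; rewrite /hd_scale mulrDr. Qed.
Lemma hd_scaleDl x : {morph hd_scale^~ x : r s / r + s}.
Proof. by move=> r s; rewrite /hd_scale hdD mulrDl. Qed.
HB.instance Definition _ := GRing.Zmodule_isLmodule.Build R hdiff
  hd_scaleA hd_scale1 hd_scaleDr hd_scaleDl.

Lemma hd_scaleE r x : r *: x = hd 0 r * x. Proof. by []. Qed.

Lemma hd_scaleAl r (x y : hdiff) : r *: (x * y) = r *: x * y.
Proof. by rewrite !hd_scaleE mulrA. Qed.
HB.instance Definition _ := GRing.Lmodule_isLalgebra.Build R hdiff hd_scaleAl.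
HB.instance Definition _ := GRing.Lalgebra_isComAlgebra.Build R hdiff.

Lemma hd0E r : hd 0 r = r%:A. Proof. by rewrite hd_scaleE mulr1. Qed.

Section Lift.
Variables (B : comNzRingType) (g : nat -> R -> B) (gP : hdcompat g).

Definition hdlift (x : hdiff) : B := let _ := gP in hdeval g (rep x).

Lemma hdlift_cls t : hdlift (cls hd_eqv t) = hdeval g t.
Proof. exact/(hdeval_eq gP)/(rep_cls hd_eqv). Qed.

Lemma hdlift_hd k r : hdlift (hd k r) = g k r.
Proof. exact: hdlift_cls. Qed.

Lemma hdlift_is_additive : zmod_morphism hdlift.
Proof.
move=> x y; case: (clsP x) (clsP y) => t -> [u ->].
have -> : (cls hd_eqv t : hdiff) - (cls hd_eqv u : hdiff) =
    cls hd_eqv (HAdd t (HOpp u)) by rewrite -hd_addE -hd_oppE.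
by rewrite !hdlift_cls.
Qed.

Lemma hdlift_is_multiplicative : monoid_morphism hdlift.
Proof.
split=> [|x y]; first by rewrite -hd01 hdlift_hd (hdcompat1 gP).
case: (clsP x) (clsP y) => t -> [u ->].
by rewrite [_ * _]hd_mulE !hdlift_cls.
Qed.

HB.instance Definition _ :=
  GRing.isZmodMorphism.Build hdiff B hdlift hdlift_is_additive.
HB.instance Definition _ :=
  GRing.isMonoidMorphism.Build hdiff B hdlift hdlift_is_multiplicative.
End Lift.

Inductive hdeg : nat -> hdiff -> Prop :=
  | hdeg_gen k r : hdeg k (hd k r)
  | hdeg0 k : hdeg k 0
  | hdegD k x y : hdeg k x -> hdeg k y -> hdeg k (x + y)
  | hdegN k x : hdeg k x -> hdeg k (- x)
  | hdegM i j x y : hdeg i x -> hdeg j y -> hdeg (i + j) (x * y).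

Lemma hdeg_sum k I (r : seq I) (P : pred I) (F : I -> hdiff) :
  (forall i, P i -> hdeg k (F i)) -> hdeg k (\sum_(i <- r | P i) F i).
Proof.
by move=> FP; elim/big_rec: _ => [|i x Pi]; [apply: hdeg0|apply/hdegD/FP].
Qed.

Lemma hdegMn k x n : hdeg k x -> hdeg k (x *+ n).
Proof.
by move=> kx; elim: n => [|n IHn]; rewrite ?mulrS; [apply: hdeg0|apply: hdegD].
Qed.

(** [d_Omega] sends [d^(i) r] to [sum_j 'C(i + j, j) d^(i + j) r]; the power of
    the indeterminate records by how much the degree is raised. *)
Definition dOmega_gen (i : nat) (r : R) : fps hdiff :=
  fun j => hd (i + j) r *+ 'C(i + j, j).

Lemma dOmega_gen_compat : hdcompat dOmega_gen.
Proof.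
split.
- apply/funext => j; rewrite fps1E /dOmega_gen add0n binn mulr1n.
  case: j => [|j] //=; by rewrite -[1](scale1r (1 : R)) hdK.
- move=> k r s; apply/funext => j; rewrite fpsDE /dOmega_gen hdD.
  by rewrite mulrnDl.
- move=> k a k_gt0; apply/funext => j; rewrite fps0E /dOmega_gen hdK ?mul0rn //.
  by rewrite addn_gt0 k_gt0.
move=> k r s; apply/funext => n; rewrite fps_sumE /dOmega_gen.
pose G l := hd l r * hd (k + n - l) s.
pose H l j := G l *+ ('C(l, j) * 'C(k + n - l, n - j)).
transitivity (\sum_(j < n.+1) \sum_(i < k.+1) H (i + j)%N j); last first.
  rewrite exchange_big /=; apply: eq_bigr => i _.
  rewrite fpsME; apply: eq_bigr => j _; rewrite /H /G /dOmega_gen.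
  have -> : (k + n - (i + j) = k - i + (n - j))%N.
    by have := ltn_ord i; have := ltn_ord j; lia.
  by rewrite mulrnAl mulrnAr -mulrnA mulnC.
transitivity (\sum_(j < n.+1) \sum_(l < (k + n).+1) H l j).
  rewrite hdM exchange_big -sumrMnl; apply: eq_bigr => l _ /=.
  rewrite -/(G l) /H sumrMnr binomial.Vandermonde.
  by rewrite subnKC // -ltnS.
apply: eq_bigr => j _; have lt_jn := ltn_ord j.
rewrite -(big_mkord predT (H^~ j)).
rewrite (big_cat_nat (n := j)) /=; [|by []|by lia].
rewrite [X in X + _]big_nat [X in X + _]big1 ?add0r; last first.
  by move=> l /andP[_ lt_lj]; rewrite /H bin_small ?mul0n.
rewrite (big_cat_nat (n := (j + k).+1)) /=; [|by lia|by lia].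
rewrite [X in _ + X]big_nat [X in _ + X]big1 ?addr0; last first.
  move=> l /andP[lt_l lt_ln]; rewrite /H ['C(k + n - l, _)]bin_small ?muln0 //.
  by lia.
rewrite -{1}[j : nat]add0n big_addn -addnS addKn big_mkord.
by apply: eq_bigr.
Qed.

Definition dOmega : hdiff -> fps hdiff := hdlift dOmega_gen_compat.
HB.instance Definition _ := GRing.RMorphism.on dOmega.

(** The part of [d_Omega] that raises degrees by [j]. *)
Definition dOmega_ (j : nat) (w : hdiff) : hdiff := dOmega w j.

Lemma dOmega_hd j i r : dOmega_ j (hd i r) = hd (i + j) r *+ 'C(i + j, j).
Proof. by rewrite /dOmega_ /dOmega hdlift_hd. Qed.

Lemma dOmega_D j x y : dOmega_ j (x + y) = dOmega_ j x + dOmega_ j y.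
Proof. by rewrite /dOmega_ rmorphD. Qed.

Lemma dOmega_M j x y :
  dOmega_ j (x * y) = \sum_(a < j.+1) dOmega_ a x * dOmega_ (j - a) y.
Proof. by rewrite /dOmega_ rmorphM. Qed.

Lemma dOmega_Z j r x :
  dOmega_ j (r *: x) = \sum_(a < j.+1) hd a r * dOmega_ (j - a) x.
Proof.
rewrite hd_scaleE dOmega_M; apply: eq_bigr => a _.
by rewrite dOmega_hd add0n binn.
Qed.

Lemma dOmega_deg j k x : hdeg k x -> hdeg (k + j) (dOmega_ j x).
Proof.
move=> kx; elim: kx j => {k x}.
- by move=> k r j; rewrite dOmega_hd; apply/hdegMn/hdeg_gen.
- by move=> k j; rewrite /dOmega_ rmorph0 fps0E; apply: hdeg0.
- by move=> k x y _ IHx _ IHy j; rewrite dOmega_D; apply: hdegD.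
- by move=> k x _ IHx j; rewrite /dOmega_ rmorphN; apply/hdegN/IHx.
- move=> i k x y _ IHx _ IHy j; rewrite dOmega_M; apply: hdeg_sum => a _.
  have -> : (i + k + j = (i + a) + (k + (j - a)))%N.
    by have := ltn_ord a; lia.
  exact: hdegM.
Qed.

End HigherDifferentials.

Section TensorProduct.
Variables (R : comNzRingType) (V M : lmodType R).

Inductive tterm : Type :=
  | TPure of V & M
  | TZero
  | TAdd of tterm & tterm
  | TOpp of tterm.

Inductive teq : tterm -> tterm -> Prop :=
  | teq_refl t : teq t t
  | teq_sym t u : teq t u -> teq u t
  | teq_trans t u v : teq t u -> teq u v -> teq t v
  | teq_add t t' u u' : teq t t' -> teq u u' -> teq (TAdd t u) (TAdd t' u')
  | teq_opp t t' : teq t t' -> teq (TOpp t) (TOpp t')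
  | teq_addA t u v : teq (TAdd t (TAdd u v)) (TAdd (TAdd t u) v)
  | teq_addC t u : teq (TAdd t u) (TAdd u t)
  | teq_add0 t : teq (TAdd TZero t) t
  | teq_addN t : teq (TAdd (TOpp t) t) TZero
  | teq_pureDl v w m : teq (TPure (v + w) m) (TAdd (TPure v m) (TPure w m))
  | teq_pureDr v m n : teq (TPure v (m + n)) (TAdd (TPure v m) (TPure v n))
  | teq_pureZ r v m : teq (TPure (r *: v) m) (TPure v (r *: m)).

Definition t_eqv := EquivalenceOn teq_refl teq_sym teq_trans.

Definition tensor : Type := quot t_eqv.

HB.instance Definition _ := gen_eqMixin tensor.
HB.instance Definition _ := gen_choiceMixin tensor.

Definition pure (v : V) (m : M) : tensor := cls t_eqv (TPure v m).
Definition t_zero : tensor := cls t_eqv TZero.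
Definition t_add (x y : tensor) : tensor := cls t_eqv (TAdd (rep x) (rep y)).
Definition t_opp (x : tensor) : tensor := cls t_eqv (TOpp (rep x)).

Lemma t_addE t u : t_add (cls t_eqv t) (cls t_eqv u) = cls t_eqv (TAdd t u).
Proof. by apply/cls_eq/teq_add; apply: (rep_cls t_eqv). Qed.
Lemma t_oppE t : t_opp (cls t_eqv t) = cls t_eqv (TOpp t).
Proof. by apply/cls_eq/teq_opp; apply: (rep_cls t_eqv). Qed.

Lemma t_addA : associative t_add.
Proof.
move=> x y z; case: (clsP x) (clsP y) (clsP z) => t -> [u ->] [v ->].
by rewrite !t_addE; apply/cls_eq/teq_addA.
Qed.
Lemma t_addC : commutative t_add.
Proof.
move=> x y; case: (clsP x) (clsP y) => t -> [u ->].
by rewrite !t_addE; apply/cls_eq/teq_addC.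
Qed.
Lemma t_add0 : left_id t_zero t_add.
Proof.
by move=> x; case: (clsP x) => t ->; rewrite t_addE; apply/cls_eq/teq_add0.
Qed.
Lemma t_addN : left_inverse t_zero t_opp t_add.
Proof.
move=> x; case: (clsP x) => t ->; rewrite t_oppE t_addE.
exact/cls_eq/teq_addN.
Qed.
HB.instance Definition _ :=
  GRing.isZmodule.Build tensor t_addA t_addC t_add0 t_addN.

Lemma pureDl v w m : pure (v + w) m = pure v m + pure w m.
Proof. by rewrite [RHS]t_addE; apply/cls_eq/teq_pureDl. Qed.
Lemma pureDr v m n : pure v (m + n) = pure v m + pure v n.
Proof. by rewrite [RHS]t_addE; apply/cls_eq/teq_pureDr. Qed.
Lemma pureZ r v m : pure (r *: v) m = pure v (r *: m).
Proof. exact/cls_eq/teq_pureZ. Qed.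

Lemma tensor_ind (P : tensor -> Prop) :
    (forall v m, P (pure v m)) -> P 0 ->
    (forall x y, P x -> P y -> P (x + y)) -> (forall x, P x -> P (- x)) ->
  forall x, P x.
Proof.
move=> Ppure P0 Padd Popp x; case: (clsP x) => t ->.
elim: t => [v m||t Pt u Pu|t Pt]; [exact: Ppure|exact: P0| |].
- by rewrite -t_addE; apply: Padd.
- by rewrite -t_oppE; apply: Popp.
Qed.

Section Lift.
Variables (W : zmodType) (f : V -> M -> W).

Record balanced : Prop := Balanced {
  balancedDl : forall v w m, f (v + w) m = f v m + f w m;
  balancedDr : forall v m n, f v (m + n) = f v m + f v n;
  balancedZ : forall r v m, f (r *: v) m = f v (r *: m) }.

Hypothesis fP : balanced.

Fixpoint teval (t : tterm) : W :=
  match t with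
  | TPure v m => f v m
  | TZero => 0
  | TAdd t u => teval t + teval u
  | TOpp t => - teval t
  end.

Lemma teval_eq t u : teq t u -> teval t = teval u.
Proof.
case: fP => fDl fDr fZ; elim=> {t u} //=.
- by move=> t u v _ -> _ ->.
- by move=> t t' u u' _ -> _ ->.
- by move=> t t' _ ->.
- by move=> t u v; apply: addrA.
- by move=> t u; apply: addrC.
- by move=> t; apply: add0r.
- by move=> t; apply: addNr.
Qed.

Definition tlift (x : tensor) : W := let _ := fP in teval (rep x).

Lemma tlift_cls t : tlift (cls t_eqv t) = teval t.
Proof. exact/teval_eq/(rep_cls t_eqv). Qed.

Lemma tlift_pure v m : tlift (pure v m) = f v m.
Proof. exact: tlift_cls. Qed.

Lemma tlift_is_additive : zmod_morphism tlift.
Proof.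
move=> x y; case: (clsP x) (clsP y) => t -> [u ->].
have -> : (cls t_eqv t : tensor) - (cls t_eqv u : tensor) =
    cls t_eqv (TAdd t (TOpp u)) by rewrite -t_addE -t_oppE.
by rewrite !tlift_cls.
Qed.
HB.instance Definition _ :=
  GRing.isZmodMorphism.Build tensor W tlift tlift_is_additive.
End Lift.

Lemma t_scale_balanced (r : R) : balanced (fun v m => pure (r *: v) m).
Proof.
split=> [v w m|v m n|s v m]; first by rewrite scalerDr pureDl.
- exact: pureDr.
- by rewrite scalerA mulrC -scalerA pureZ.
Qed.
Definition t_scale (r : R) : tensor -> tensor := tlift (t_scale_balanced r).
HB.instance Definition _ r := GRing.Additive.on (t_scale r).

Lemma t_scale_pure r v m : t_scale r (pure v m) = pure (r *: v) m.
Proof. exact: tlift_pure. Qed.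

Lemma t_scale_r0 r : t_scale r 0 = 0. Proof. exact: raddf0. Qed.
Lemma t_scale_rD r x y : t_scale r (x + y) = t_scale r x + t_scale r y.
Proof. exact: raddfD. Qed.
Lemma t_scale_rN r x : t_scale r (- x) = - t_scale r x.
Proof. exact: raddfN. Qed.

Lemma t_scaleA r s x : t_scale r (t_scale s x) = t_scale (r * s) x.
Proof.
elim/tensor_ind: x => [v m||x y IHx IHy|x IHx].
- by rewrite !t_scale_pure scalerA.
- by rewrite !t_scale_r0.
- by rewrite !t_scale_rD IHx IHy.
- by rewrite !t_scale_rN IHx.
Qed.
Lemma t_scale1 : left_id 1 t_scale.
Proof.
elim/tensor_ind=> [v m||x y IHx IHy|x IHx].
- by rewrite !t_scale_pure scale1r.
- by rewrite !t_scale_r0.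
- by rewrite !t_scale_rD IHx IHy.
- by rewrite !t_scale_rN IHx.
Qed.
Lemma t_scaleDr : right_distributive t_scale +%R.
Proof. by move=> r x y; rewrite t_scale_rD. Qed.
Lemma t_scaleDl x : {morph t_scale^~ x : r s / r + s}.
Proof.
move=> r s; elim/tensor_ind: x => [v m||x y IHx IHy|x IHx].
- by rewrite !t_scale_pure scalerDl pureDl.
- by rewrite !t_scale_r0 addr0.
- by rewrite !t_scale_rD IHx IHy addrACA.
- by rewrite !t_scale_rN IHx opprD.
Qed.
HB.instance Definition _ := GRing.Zmodule_isLmodule.Build R tensor
  t_scaleA t_scale1 t_scaleDr t_scaleDl.

Lemma pure_scale r v m : r *: pure v m = pure (r *: v) m.
Proof. exact: t_scale_pure. Qed.
End TensorProduct.

Section TensorMap.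
Variables (R : comNzRingType) (V M N : lmodType R) (f : {linear M -> N}).

Lemma tmap_balanced : balanced (fun (v : V) m => pure v (f m)).
Proof.
split=> [v w m|v m n|r v m]; first exact: pureDl.
- by rewrite raddfD pureDr.
- by rewrite linearZ pureZ.
Qed.

Definition tmap : tensor V M -> tensor V N := tlift tmap_balanced.
HB.instance Definition _ := GRing.Additive.on tmap.

Lemma tmap_pure v m : tmap (pure v m) = pure v (f m).
Proof. exact: tlift_pure. Qed.
Lemma tmap_0 : tmap 0 = 0. Proof. exact: raddf0. Qed.
Lemma tmap_D x y : tmap (x + y) = tmap x + tmap y. Proof. exact: raddfD. Qed.
Lemma tmap_N x : tmap (- x) = - tmap x. Proof. exact: raddfN. Qed.
End TensorMap.

Lemma tmap_id (R : comNzRingType) (V M : lmodType R) (x : tensor V M) :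
  tmap (idfun : {linear M -> M}) x = x.
Proof.
elim/tensor_ind: x => [v m||x y IHx IHy|x IHx].
- by rewrite tmap_pure.
- exact: tmap_0.
- by rewrite tmap_D IHx IHy.
- by rewrite tmap_N IHx.
Qed.

Lemma tmap_comp (R : comNzRingType) (V M N P : lmodType R)
    (g : {linear N -> P}) (f : {linear M -> N}) (x : tensor V M) :
  tmap (g \o f : {linear M -> P}) x = tmap g (tmap f x).
Proof.
elim/tensor_ind: x => [v m||x y IHx IHy|x IHx].
- by rewrite !tmap_pure.
- by rewrite !tmap_0.
- by rewrite !tmap_D IHx IHy.
- by rewrite !tmap_N IHx.
Qed.

(** Completion by degree: [prod_k V_k] for the graded pieces
    [V_k = {v | deg k v}] of [V]. *)
Record completion (V : Type) (deg : nat -> V -> Prop) := Completion {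
  coefs :> nat -> V;
  coefsP : forall k, deg k (coefs k) }.

Lemma completion_eq (V : Type) (deg : nat -> V -> Prop) (u v : completion deg) :
  (forall k, u k = v k) -> u = v.
Proof.
case: u v => [u uP] [v vP] /= /funext uv; case: _ / uv in vP *.
by congr Completion; apply: Prop_irrelevance.
Qed.

Section HigherConnections.
Variables (K : fieldType) (R : comAlgType K).

Definition hOmega := completion (@hdeg K R).

Definition d_R (r : R) : hOmega := Completion (fun k => hdeg_gen k r).

Section Module.
Variable M : lmodType R.

(** As [hdiff R] is graded, [Omega_k (x) M] is a direct summand of
    [hdiff R (x) M]: the span of the [w (x) m] with [w] of degree [k]. *)
Inductive tdeg : nat -> tensor (hdiff R) M -> Prop :=
  | tdeg_pure k w m : hdeg k w -> tdeg k (pure w m)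
  | tdeg0 k : tdeg k 0
  | tdegD k x y : tdeg k x -> tdeg k y -> tdeg k (x + y)
  | tdegN k x : tdeg k x -> tdeg k (- x).

Lemma tdeg_sum k I (r : seq I) (P : pred I) (F : I -> tensor (hdiff R) M) :
  (forall i, P i -> tdeg k (F i)) -> tdeg k (\sum_(i <- r | P i) F i).
Proof.
by move=> FP; elim/big_rec: _ => [|i x Pi]; [apply: tdeg0|apply/tdegD/FP].
Qed.

Definition hOmegaM := completion tdeg.

Lemma hact_balanced (w : hdiff R) :
  balanced (fun (v : hdiff R) (m : M) => pure (w * v) m).
Proof.
split=> [v v' m|v m n|r v m]; first by rewrite mulrDr pureDl.
- exact: pureDr.
- by rewrite -scalerAr pureZ.
Qed.

Definition hact (w : hdiff R) : tensor (hdiff R) M -> tensor (hdiff R) M :=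
  tlift (hact_balanced w).
HB.instance Definition _ w := GRing.Additive.on (hact w).

Lemma hact_pure w v m : hact w (pure v m) = pure (w * v) m.
Proof. exact: tlift_pure. Qed.
Lemma hact_r0 w : hact w 0 = 0. Proof. exact: raddf0. Qed.
Lemma hact_rD w x y : hact w (x + y) = hact w x + hact w y.
Proof. exact: raddfD. Qed.
Lemma hact_rN w x : hact w (- x) = - hact w x.
Proof. exact: raddfN. Qed.
Lemma hact_sum w I (r : seq I) (P : pred I) (F : I -> tensor (hdiff R) M) :
  hact w (\sum_(i <- r | P i) F i) = \sum_(i <- r | P i) hact w (F i).
Proof. exact: raddf_sum. Qed.

Lemma hact_l0 x : hact 0 x = 0.
Proof.
elim/tensor_ind: x => [v m||x y IHx IHy|x IHx].
- rewrite hact_pure mul0r; apply: (addrI (pure 0 m)).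
  by rewrite -pureDl !addr0.
- exact: hact_r0.
- by rewrite hact_rD IHx IHy addr0.
- by rewrite hact_rN IHx oppr0.
Qed.
Lemma hactD v w x : hact (v + w) x = hact v x + hact w x.
Proof.
elim/tensor_ind: x => [u m||x y IHx IHy|x IHx].
- by rewrite !hact_pure mulrDl pureDl.
- by rewrite !hact_r0 addr0.
- by rewrite !hact_rD IHx IHy addrACA.
- by rewrite !hact_rN IHx opprD.
Qed.
Lemma hact_suml I (r : seq I) (P : pred I) (F : I -> hdiff R) x :
  hact (\sum_(i <- r | P i) F i) x = \sum_(i <- r | P i) hact (F i) x.
Proof. by elim/big_rec2: _ => [|i y1 y2 _ <-]; rewrite ?hact_l0 ?hactD. Qed.
Lemma hactM v w x : hact (v * w) x = hact v (hact w x).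
Proof.
elim/tensor_ind: x => [u m||x y IHx IHy|x IHx].
- by rewrite !hact_pure mulrA.
- by rewrite !hact_r0.
- by rewrite !hact_rD IHx IHy.
- by rewrite !hact_rN IHx.
Qed.

Lemma tdeg_hact i j w x : hdeg i w -> tdeg j x -> tdeg (i + j) (hact w x).
Proof.
move=> iw; elim=> {j x} [k v m kv|k|k x y _ IHx _ IHy|k x _ IHx].
- by rewrite hact_pure; apply/tdeg_pure/hdegM.
- by rewrite hact_r0; apply: tdeg0.
- by rewrite hact_rD; apply: tdegD.
- by rewrite hact_rN; apply: tdegN.
Qed.

Lemma hactc_subproof (w : hOmega) (u : hOmegaM) k :
  tdeg k (\sum_(i < k.+1) hact (w i) (u (k - i)%N)).
Proof.
apply: tdeg_sum => i _; have {1}-> : k = (i + (k - i))%N.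
  by rewrite subnKC // -ltnS.
by apply: tdeg_hact; apply: coefsP.
Qed.

Definition hactc (w : hOmega) (u : hOmegaM) : hOmegaM :=
  Completion (hactc_subproof w u).

Record hconn := HConn {
  nabla :> M -> hOmegaM;
  nablaD : forall x y k, nabla (x + y) k = nabla x k + nabla y k;
  nablaZ : forall r m, nabla (r *: m) = hactc (d_R r) (nabla m);
  nabla0 : forall m, nabla m 0 = pure 1 m }.

Section Extension.
Variable N : hconn.

Lemma ext_nabla_balanced (i : nat) :
  balanced (fun (w : hdiff R) (m : M) =>
    \sum_(j < i.+1) hact (dOmega_ j w) (N m (i - j)%N)).
Proof.
split=> [v w m|v m n|r v m].
- rewrite -big_split /=; apply: eq_bigr => j _.
  by rewrite dOmega_D hactD.
- rewrite -big_split /=; apply: eq_bigr => j _.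
  by rewrite nablaD hact_rD.
pose F a b c := hact (hd a r * dOmega_ b v) (N m c).
transitivity (\sum_(j < i.+1) \sum_(a < j.+1) F a (j - a)%N (i - j)%N).
  apply: eq_bigr => j _; rewrite dOmega_Z hact_suml; exact: eq_bigr.
rewrite sum_triangle sum_triangle_sym; apply: eq_bigr => j _.
rewrite nablaZ /= hact_sum; apply: eq_bigr => a _.
by rewrite /F mulrC hactM.
Qed.

(** [w (x) m |-> sum_(j + l = i) d_Omega^(j) (w) nabla^(l) (m)] is the part of
    [w (x) m |-> d_Omega (w) nabla (m)] that raises degrees by [i], on
    [Omega (x) M]. *)
Definition ext_nabla (i : nat) : tensor (hdiff R) M -> tensor (hdiff R) M :=
  tlift (ext_nabla_balanced i).
HB.instance Definition _ i := GRing.Additive.on (ext_nabla i).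

Lemma ext_nabla_pure i w m : ext_nabla i (pure w m) =
  \sum_(j < i.+1) hact (dOmega_ j w) (N m (i - j)%N).
Proof. exact: tlift_pure. Qed.
Lemma ext_nabla_0 i : ext_nabla i 0 = 0. Proof. exact: raddf0. Qed.
Lemma ext_nabla_D i x y : ext_nabla i (x + y) = ext_nabla i x + ext_nabla i y.
Proof. exact: raddfD. Qed.
Lemma ext_nabla_N i x : ext_nabla i (- x) = - ext_nabla i x.
Proof. exact: raddfN. Qed.

Lemma ext_nabla_deg i k x : tdeg k x -> tdeg (k + i) (ext_nabla i x).
Proof.
elim=> {k x} [k w m kw|k|k x y _ IHx _ IHy|k x _ IHx].
- rewrite ext_nabla_pure; apply: tdeg_sum => j _.
  have -> : (k + i = k + j + (i - j))%N by have := ltn_ord j; lia.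
  by apply: tdeg_hact; [apply: dOmega_deg|apply: coefsP].
- by rewrite ext_nabla_0; apply: tdeg0.
- by rewrite ext_nabla_D; apply: tdegD.
- by rewrite ext_nabla_N; apply: tdegN.
Qed.

Lemma ext_nablac_subproof i (u : hOmegaM) k :
  tdeg k (if (i <= k)%N then ext_nabla i (u (k - i)%N) else 0).
Proof.
case: leqP => [le_ik|_]; last exact: tdeg0.
have {1}-> : k = (k - i + i)%N by rewrite subnK.
by apply: ext_nabla_deg; apply: coefsP.
Qed.

Definition ext_nablac (i : nat) (u : hOmegaM) : hOmegaM :=
  Completion (ext_nablac_subproof i u).
End Extension.

Definition iterative (N : hconn) : Prop := forall i j u k,
  ext_nablac N i (ext_nablac N j u) k = ext_nablac N (i + j) u k *+ 'C(i + j, i).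
End Module.

Record hder := HDer {
  hder_fun :> {rmorphism R -> fps R};
  hderK : forall a : K, hder_fun a%:A = fpsC a%:A;
  hder0 : forall r, hder_fun r 0 = r }.

(** [psi[[T]] : R[[T]] -> R[[T]]] *)
Definition hder_ext (psi : R -> fps R) (f : fps R) : fps R :=
  fun n => \sum_(i < n.+1) psi (f i) (n - i)%N.

Section HderExt.
Variable psi : hder.

Lemma hder_ext_is_additive : zmod_morphism (hder_ext psi).
Proof.
move=> f g; apply/funext => n; rewrite fpsBE /hder_ext -sumrB.
by apply: eq_bigr => i _; rewrite fpsBE rmorphB fpsBE.
Qed.

Lemma hder_ext_is_multiplicative : monoid_morphism (hder_ext psi).
Proof.
split=> [|f g]; apply/funext => n; rewrite /hder_ext.
  rewrite fps1E big_ord_recl big1 ?addr0 => [|i _].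
    by rewrite fps1E /= rmorph1 subn0.
  by rewrite fps1E /= rmorph0 fps0E.
pose P j l a b := psi (f j) a * psi (g l) b.
transitivity (\sum_(i < n.+1) \sum_(j < i.+1) (fun j l c =>
    \sum_(a < c.+1) P j l a (c - a)%N) j (i - j)%N (n - i)%N).
  apply: eq_bigr => i _; rewrite fpsME rmorph_sum fps_sumE.
  by apply: eq_bigr => j _; rewrite rmorphM.
transitivity (\sum_(i < n.+1) \sum_(j < i.+1) (fun j a c =>
    \sum_(l < c.+1) P j l a (c - l)%N) j (i - j)%N (n - i)%N); last first.
  apply/esym; rewrite fpsME; apply: eq_bigr => i _; rewrite mulr_suml.
  by apply: eq_bigr => j _; rewrite mulr_sumr.
rewrite (sum_triangle n (fun j l c => \sum_(a < c.+1) P j l a (c - a)%N)).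
rewrite (sum_triangle n (fun j a c => \sum_(l < c.+1) P j l a (c - l)%N)).
by apply: eq_bigr => j _; rewrite (sum_triangle_sym _ (P j)).
Qed.

HB.instance Definition _ := GRing.isZmodMorphism.Build
  (fps R) (fps R) (hder_ext psi) hder_ext_is_additive.
HB.instance Definition _ := GRing.isMonoidMorphism.Build
  (fps R) (fps R) (hder_ext psi) hder_ext_is_multiplicative.
End HderExt.

Section HderComp.
Variables psi1 psi2 : hder.

Definition hder_comp_fun : {rmorphism R -> fps R} := hder_ext psi1 \o psi2.

Lemma hder_compK (a : K) : hder_comp_fun a%:A = fpsC a%:A.
Proof.
apply/funext => n; rewrite /= hderK /hder_ext big_ord_recl big1 => [|i _].
  by rewrite addr0 hderK subn0.
by rewrite /fpsC /= rmorph0 fps0E.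
Qed.

Lemma hder_comp0 r : hder_comp_fun r 0 = r.
Proof. by rewrite /= /hder_ext big_ord1 !hder0. Qed.

Definition hder_comp : hder := HDer hder_compK hder_comp0.
End HderComp.

Lemma tilde_compat (psi : hder) :
  hdcompat (fun k (r : R) => fpsm k (psi r k)).
Proof.
split=> [|k r s|k a k_gt0|k r s].
- by rewrite hder0.
- by rewrite rmorphD fpsDE fpsm_add.
- by rewrite hderK /fpsC gtn_eqF // fpsm0.
- rewrite rmorphM fpsME fpsm_sum; apply: eq_bigr => i _.
  by rewrite fpsm_mul subnKC // -ltnS.
Qed.

(** The restriction of [psi~] to [Omega]. *)
Definition tilde (psi : hder) : hdiff R -> fps R := hdlift (tilde_compat psi).
HB.instance Definition _ psi := GRing.RMorphism.on (tilde psi).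

Lemma tilde_hd psi k r : tilde psi (hd k r) = fpsm k (psi r k).
Proof. exact: hdlift_hd. Qed.

Section NablaPsi.
Variable M : lmodType R.

Lemma tildeM_balanced (psi : hder) (n : nat) :
  balanced (fun (w : hdiff R) (m : M) => tilde psi w n *: m).
Proof.
split=> [v w m|v m k|r v m].
- by rewrite rmorphD fpsDE scalerDl.
- exact: scalerDr.
- rewrite hd_scaleE rmorphM /= tilde_hd hder0.
  rewrite (_ : (fpsm 0 r * tilde psi v : fps R) n = r * tilde psi v n);
    last exact: fpsC_mul.
  by rewrite mulrC scalerA.
Qed.

(** [psi~ (x) id_M : hOmega (x) M -> M[[T]]]. The coefficient of [T^n] only
    involves the component of degree [n], which [psi~] sends into [M T^n]. *)
Definition tildeM (psi : hder) (u : hOmegaM M) : fps M :=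
  fun n => tlift (tildeM_balanced psi n) (u n).

Definition nabla_psi (N : hconn M) (psi : hder) (m : M) : fps M :=
  tildeM psi (N m).

(** [g[[T]] : M[[T]] -> M[[T]]] for [g : M -> M[[T]]] *)
Definition fps_ext (g : M -> fps M) (f : fps M) : fps M :=
  fun n => \sum_(i < n.+1) g (f i) (n - i)%N.

Definition hintegrable (N : hconn M) : Prop :=
  forall (psi1 psi2 : hder) (m : M),
    nabla_psi N (hder_comp psi1 psi2) m =
    fps_ext (nabla_psi N psi1) (nabla_psi N psi2 m).
End NablaPsi.

Inductive kterm : Type :=
  | KGen of R
  | KZero
  | KAdd of kterm & kterm
  | KOpp of kterm
  | KScale of R & kterm.

Inductive keq : kterm -> kterm -> Prop :=
  | keq_refl t : keq t t
  | keq_sym t u : keq t u -> keq u t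
  | keq_trans t u v : keq t u -> keq u v -> keq t v
  | keq_add t t' u u' : keq t t' -> keq u u' -> keq (KAdd t u) (KAdd t' u')
  | keq_opp t t' : keq t t' -> keq (KOpp t) (KOpp t')
  | keq_scale r t t' : keq t t' -> keq (KScale r t) (KScale r t')
  | keq_addA t u v : keq (KAdd t (KAdd u v)) (KAdd (KAdd t u) v)
  | keq_addC t u : keq (KAdd t u) (KAdd u t)
  | keq_add0 t : keq (KAdd KZero t) t
  | keq_addN t : keq (KAdd (KOpp t) t) KZero
  | keq_scaleA r s t : keq (KScale r (KScale s t)) (KScale (r * s) t)
  | keq_scale1 t : keq (KScale 1 t) t
  | keq_scaleDr r t u : keq (KScale r (KAdd t u)) (KAdd (KScale r t) (KScale r u))
  | keq_scaleDl r s t : keq (KScale (r + s) t) (KAdd (KScale r t) (KScale s t))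
  | keq_genD r s : keq (KGen (r + s)) (KAdd (KGen r) (KGen s))
  | keq_genK (a : K) : keq (KGen a%:A) KZero
  | keq_genM r s :
      keq (KGen (r * s)) (KAdd (KScale r (KGen s)) (KScale s (KGen r))).

Definition k_eqv := EquivalenceOn keq_refl keq_sym keq_trans.

(** [Omega_(R/K)] *)
Definition kahler : Type := quot k_eqv.

HB.instance Definition _ := gen_eqMixin kahler.
HB.instance Definition _ := gen_choiceMixin kahler.

Definition kd (r : R) : kahler := cls k_eqv (KGen r).
Definition k_zero : kahler := cls k_eqv KZero.
Definition k_add (x y : kahler) : kahler := cls k_eqv (KAdd (rep x) (rep y)).
Definition k_opp (x : kahler) : kahler := cls k_eqv (KOpp (rep x)).
Definition k_scale (r : R) (x : kahler) : kahler := cls k_eqv (KScale r (rep x)).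

Lemma k_addE t u : k_add (cls k_eqv t) (cls k_eqv u) = cls k_eqv (KAdd t u).
Proof. by apply/cls_eq/keq_add; apply: (rep_cls k_eqv). Qed.
Lemma k_oppE t : k_opp (cls k_eqv t) = cls k_eqv (KOpp t).
Proof. by apply/cls_eq/keq_opp; apply: (rep_cls k_eqv). Qed.
Lemma k_scaleE r t : k_scale r (cls k_eqv t) = cls k_eqv (KScale r t).
Proof. by apply/cls_eq/keq_scale; apply: (rep_cls k_eqv). Qed.

Lemma k_addA : associative k_add.
Proof.
move=> x y z; case: (clsP x) (clsP y) (clsP z) => t -> [u ->] [v ->].
by rewrite !k_addE; apply/cls_eq/keq_addA.
Qed.
Lemma k_addC : commutative k_add.
Proof.
move=> x y; case: (clsP x) (clsP y) => t -> [u ->].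
by rewrite !k_addE; apply/cls_eq/keq_addC.
Qed.
Lemma k_add0 : left_id k_zero k_add.
Proof.
by move=> x; case: (clsP x) => t ->; rewrite k_addE; apply/cls_eq/keq_add0.
Qed.
Lemma k_addN : left_inverse k_zero k_opp k_add.
Proof.
move=> x; case: (clsP x) => t ->; rewrite k_oppE k_addE.
exact/cls_eq/keq_addN.
Qed.
HB.instance Definition _ :=
  GRing.isZmodule.Build kahler k_addA k_addC k_add0 k_addN.

Lemma k_scaleA r s x : k_scale r (k_scale s x) = k_scale (r * s) x.
Proof.
by case: (clsP x) => t ->; rewrite !k_scaleE; apply/cls_eq/keq_scaleA.
Qed.
Lemma k_scale1 : left_id 1 k_scale.
Proof.
by move=> x; case: (clsP x) => t ->; rewrite k_scaleE; apply/cls_eq/keq_scale1.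
Qed.
Lemma k_scaleDr : right_distributive k_scale +%R.
Proof.
move=> r x y; case: (clsP x) (clsP y) => t -> [u ->].
have -> : (cls k_eqv t : kahler) + (cls k_eqv u : kahler) =
    cls k_eqv (KAdd t u) by rewrite -k_addE.
rewrite !k_scaleE [RHS]k_addE; exact/cls_eq/keq_scaleDr.
Qed.
Lemma k_scaleDl x : {morph k_scale^~ x : r s / r + s}.
Proof.
move=> r s; case: (clsP x) => t ->; rewrite !k_scaleE [RHS]k_addE.
exact/cls_eq/keq_scaleDl.
Qed.
HB.instance Definition _ := GRing.Zmodule_isLmodule.Build R kahler
  k_scaleA k_scale1 k_scaleDr k_scaleDl.

Lemma kdD r s : kd (r + s) = kd r + kd s.
Proof. by rewrite [RHS]k_addE; apply/cls_eq/keq_genD. Qed.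
Lemma kdK (a : K) : kd a%:A = 0. Proof. exact/cls_eq/keq_genK. Qed.
Lemma kdM r s : kd (r * s) = r *: kd s + s *: kd r.
Proof.
have -> : r *: kd s + s *: kd r =
    cls k_eqv (KAdd (KScale r (KGen s)) (KScale s (KGen r))).
  by rewrite -k_addE -!k_scaleE.
exact/cls_eq/keq_genM.
Qed.

Lemma kahler_ind (P : kahler -> Prop) :
    (forall r, P (kd r)) -> P 0 -> (forall x y, P x -> P y -> P (x + y)) ->
    (forall r x, P x -> P (r *: x)) ->
  forall x, P x.
Proof.
move=> Pgen P0 Padd Pscale x; case: (clsP x) => t ->.
elim: t => [r||t Pt u Pu|t Pt|r t Pt]; [exact: Pgen|exact: P0| | |].
- by rewrite -k_addE; apply: Padd.
- rewrite -k_oppE -[k_opp _]/(- (cls k_eqv t : kahler)) -scaleN1r.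
  exact: Pscale.
- by rewrite -k_scaleE; apply: Pscale.
Qed.

Record kder := KDer {
  kder_fun :> {linear R -> R};
  kderM : forall r s, kder_fun (r * s) = r * kder_fun s + s * kder_fun r }.

Lemma kderK (D : kder) (a : K) : D a%:A = 0.
Proof.
rewrite linearZ /=; have /eqP := kderM D 1 1.
rewrite mulr1 !mul1r -[X in X == _]addr0 (inj_eq (addrI _)) eq_sym => /eqP ->.
exact: scaler0.
Qed.

Section KderBracket.
Variables D1 D2 : kder.

Definition kder_bracket_fun : {linear R -> R} := (D1 \o D2) \- (D2 \o D1).

Lemma kder_bracketM r s : kder_bracket_fun (r * s) =
  r * kder_bracket_fun s + s * kder_bracket_fun r.
Proof. by rewrite /= !kderM !raddfD /= !kderM; ring. Qed.

Definition kder_bracket : kder := KDer kder_bracketM.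
End KderBracket.

Section KahlerLift.
Variable D : kder.

Fixpoint keval (t : kterm) : R :=
  match t with
  | KGen r => D r
  | KZero => 0
  | KAdd t u => keval t + keval u
  | KOpp t => - keval t
  | KScale r t => r * keval t
  end.

Lemma keval_eq t u : keq t u -> keval t = keval u.
Proof.
elim=> {t u} //=.
- by move=> t u v _ -> _ ->.
- by move=> t t' u u' _ -> _ ->.
- by move=> t t' _ ->.
- by move=> r t t' _ ->.
- by move=> t u v; apply: addrA.
- by move=> t u; apply: addrC.
- by move=> t; apply: add0r.
- by move=> t; apply: addNr.
- by move=> r s t; apply: mulrA.
- by move=> t; apply: mul1r.
- by move=> r t u; apply: mulrDr.
- by move=> r s t; apply: mulrDl.
- by move=> r s; apply: raddfD.
- by move=> a; apply: kderK.
- by move=> r s; apply: kderM.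
Qed.

Definition klift (x : kahler) : R := keval (rep x).

Lemma klift_cls t : klift (cls k_eqv t) = keval t.
Proof. exact/keval_eq/(rep_cls k_eqv). Qed.
Lemma klift_kd r : klift (kd r) = D r. Proof. exact: klift_cls. Qed.
Lemma kliftD x y : klift (x + y) = klift x + klift y.
Proof.
case: (clsP x) (clsP y) => t -> [u ->].
by rewrite [_ + _ in LHS]k_addE !klift_cls.
Qed.
Lemma kliftZ r x : klift (r *: x) = r * klift x.
Proof. by case: (clsP x) => t ->; rewrite [_ *: _]k_scaleE !klift_cls. Qed.
End KahlerLift.

Section Connections.
Variable M : lmodType R.

Record conn := Conn {
  conn_fun :> M -> tensor kahler M;
  connD : forall x y, conn_fun (x + y) = conn_fun x + conn_fun y;
  connK : forall (a : K) m, conn_fun (a%:A *: m) = a%:A *: conn_fun m;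
  connZ : forall r m, conn_fun (r *: m) = pure (kd r) m + r *: conn_fun m }.

Lemma contract_balanced (D : kder) :
  balanced (fun (w : kahler) (m : M) => klift D w *: m).
Proof.
split=> [v w m|v m n|r v m]; first by rewrite kliftD scalerDl.
- exact: scalerDr.
- by rewrite kliftZ mulrC scalerA.
Qed.

Definition contract (D : kder) : tensor kahler M -> M :=
  tlift (contract_balanced D).

Definition nabla_der (N : conn) (D : kder) (m : M) : M := contract D (N m).

Definition integrable (N : conn) : Prop := forall (D1 D2 : kder) (m : M),
  nabla_der N D1 (nabla_der N D2 m) - nabla_der N D2 (nabla_der N D1 m) =
  nabla_der N (kder_bracket D1 D2) m.
End Connections.

Definition finitely_generated (M : lmodType R) : Prop :=
  exists (n : nat) (e : 'I_n -> M),
    forall m, exists c : 'I_n -> R, m = \sum_i c i *: e i.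
End HigherConnections.

Record category := Category {
  Obj :> Type;
  Hom : Obj -> Obj -> Type;
  id_hom : forall A, Hom A A;
  comp_hom : forall A B C, Hom B C -> Hom A B -> Hom A C;
  comp_hom_idl : forall A B (f : Hom A B), comp_hom (id_hom B) f = f;
  comp_hom_idr : forall A B (f : Hom A B), comp_hom f (id_hom A) = f;
  comp_homA : forall A B C D (h : Hom C D) (g : Hom B C) (f : Hom A B),
    comp_hom h (comp_hom g f) = comp_hom (comp_hom h g) f }.

Record functor (C D : category) := Functor {
  fobj :> C -> D;
  fmap : forall A B, Hom A B -> Hom (fobj A) (fobj B);
  fmap_id : forall A, fmap (id_hom A) = id_hom (fobj A);
  fmap_comp : forall A B E (g : Hom B E) (f : Hom A B),
    fmap (comp_hom g f) = comp_hom (fmap g) (fmap f) }.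

Program Definition id_functor (C : category) : functor C C :=
  @Functor C C id (fun A B f => f) _ _.

Program Definition comp_functor (C D E : category)
    (G : functor D E) (F : functor C D) : functor C E :=
  @Functor C E (fun A => G (F A)) (fun A B f => fmap G (fmap F f)) _ _.
Next Obligation. by rewrite !fmap_id. Qed.
Next Obligation. by rewrite !fmap_comp. Qed.

Record nat_iso (C D : category) (F G : functor C D) := NatIso {
  ni_to : forall A, Hom (F A) (G A);
  ni_from : forall A, Hom (G A) (F A);
  ni_toK : forall A, comp_hom (ni_from A) (ni_to A) = id_hom (F A);
  ni_fromK : forall A, comp_hom (ni_to A) (ni_from A) = id_hom (G A);
  ni_natural : forall A B (f : Hom A B),
    comp_hom (ni_to B) (fmap F f) = comp_hom (fmap G f) (ni_to A) }.

Definition equivalent (C D : category) : Prop :=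
  exists (F : functor C D) (G : functor D C),
    inhabited (nat_iso (comp_functor G F) (id_functor C)) /\
    inhabited (nat_iso (comp_functor F G) (id_functor D)).

Definition full_subcategory (C : category) (P : C -> Prop) : category :=
  @Category {A : C | P A} (fun A B => Hom (sval A) (sval B))
    (fun A => id_hom (sval A)) (fun A B E g f => comp_hom g f)
    (fun A B f => comp_hom_idl f) (fun A B f => comp_hom_idr f)
    (fun A B E F h g f => comp_homA h g f).

Section ConnectionCategories.
Variables (K : fieldType) (R : comAlgType K).

Record hconn_module := HConnModule {
  hcm_mod :> lmodType R;
  hcm_fg : finitely_generated hcm_mod;
  hcm_nabla : hconn hcm_mod }.

Record conn_module := ConnModule {
  cm_mod :> lmodType R;
  cm_fg : finitely_generated cm_mod;
  cm_nabla : conn cm_mod }.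

Record hconn_hom (A B : hconn_module) := HConnHom {
  hconn_fun :> {linear A -> B};
  hconn_funP : forall m k,
    hcm_nabla B (hconn_fun m) k = tmap hconn_fun (hcm_nabla A m k) }.

Record conn_hom (A B : conn_module) := ConnHom {
  conn_hom_fun :> {linear A -> B};
  conn_hom_funP : forall m,
    cm_nabla B (conn_hom_fun m) = tmap conn_hom_fun (cm_nabla A m) }.

Lemma linear_eq (U V : lmodType R) (f g : {linear U -> V}) : f =1 g -> f = g.
Proof.
case: f g => f [[fD] [fZ]] [g [[gD] [gZ]]] /= /funext fg.
case: _ / fg in gD gZ *; congr GRing.Linear.Pack.
by rewrite (Prop_irrelevance fD gD) (Prop_irrelevance fZ gZ).
Qed.

Lemma hconn_hom_eq A B (f g : hconn_hom A B) : f =1 g -> f = g.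
Proof.
case: f g => f fP [g gP] /= /linear_eq fg; case: _ / fg in gP *.
by rewrite (Prop_irrelevance fP gP).
Qed.

Lemma conn_hom_eq A B (f g : conn_hom A B) : f =1 g -> f = g.
Proof.
case: f g => f fP [g gP] /= /linear_eq fg; case: _ / fg in gP *.
by rewrite (Prop_irrelevance fP gP).
Qed.

Lemma hconn_id_subproof (A : hconn_module) m k :
  hcm_nabla A (idfun m) k = tmap (idfun : {linear A -> A}) (hcm_nabla A m k).
Proof. by rewrite tmap_id. Qed.

Definition hconn_id (A : hconn_module) : hconn_hom A A :=
  HConnHom (@hconn_id_subproof A).

Lemma hconn_comp_subproof (A B C : hconn_module)
    (g : hconn_hom B C) (f : hconn_hom A B) m k :
  hcm_nabla C ((g \o f) m) k =
  tmap (g \o f : {linear A -> C}) (hcm_nabla A m k).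
Proof. by rewrite tmap_comp /= !hconn_funP. Qed.

Definition hconn_comp (A B C : hconn_module)
    (g : hconn_hom B C) (f : hconn_hom A B) : hconn_hom A C :=
  HConnHom (hconn_comp_subproof g f).

Lemma conn_id_subproof (A : conn_module) m :
  cm_nabla A (idfun m) = tmap (idfun : {linear A -> A}) (cm_nabla A m).
Proof. by rewrite tmap_id. Qed.

Definition conn_id (A : conn_module) : conn_hom A A :=
  ConnHom (@conn_id_subproof A).

Lemma conn_comp_subproof (A B C : conn_module)
    (g : conn_hom B C) (f : conn_hom A B) m :
  cm_nabla C ((g \o f) m) =
  tmap (g \o f : {linear A -> C}) (cm_nabla A m).
Proof. by rewrite tmap_comp /= !conn_hom_funP. Qed.

Definition conn_comp (A B C : conn_module)
    (g : conn_hom B C) (f : conn_hom A B) : conn_hom A C :=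
  ConnHom (conn_comp_subproof g f).

Program Definition HCon : category := @Category hconn_module hconn_hom
  hconn_id hconn_comp _ _ _.
Next Obligation. exact: hconn_hom_eq. Qed.
Next Obligation. exact: hconn_hom_eq. Qed.
Next Obligation. exact: hconn_hom_eq. Qed.

Program Definition Con : category := @Category conn_module conn_hom
  conn_id conn_comp _ _ _.
Next Obligation. exact: conn_hom_eq. Qed.
Next Obligation. exact: conn_hom_eq. Qed.
Next Obligation. exact: conn_hom_eq. Qed.

Definition ICon : category :=
  full_subcategory (fun A : HCon => iterative (hcm_nabla A)).

Definition ICon_int : category := full_subcategory
  (fun A : HCon => iterative (hcm_nabla A) /\ hintegrable (hcm_nabla A)).

Definition Con_int : category :=
  full_subcategory (fun A : Con => integrable (cm_nabla A)).

End ConnectionCategories.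

Arguments HCon {K} R.
Arguments Con {K} R.
Arguments ICon {K} R.
Arguments ICon_int {K} R.
Arguments Con_int {K} R.

Section CommutativeAlgebra.
Variable A : comNzRingType.

Definition is_ideal (I : A -> Prop) : Prop :=
  [/\ I 0, forall x y, I x -> I y -> I (x + y) & forall a x, I x -> I (a * x)].

Definition is_prime_ideal (P : A -> Prop) : Prop :=
  [/\ is_ideal P, ~ P 1 & forall x y, P (x * y) -> P x \/ P y].

Definition is_maximal_ideal (P : A -> Prop) : Prop :=
  [/\ is_ideal P, ~ P 1 & forall I : A -> Prop, is_ideal I ->
     (forall x, P x -> I x) -> (forall x, I x -> P x) \/ I 1].

Definition ideal_generated (n : nat) (e : 'I_n -> A) (x : A) : Prop :=
  exists c : 'I_n -> A, x = \sum_i c i * e i.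

Definition noetherian : Prop := forall I : A -> Prop, is_ideal I ->
  exists (n : nat) (e : 'I_n -> A), forall x, I x <-> ideal_generated e x.

Definition prime_chain (n : nat) (P : nat -> A -> Prop) : Prop :=
  (forall i, (i <= n)%N -> is_prime_ideal (P i)) /\
  (forall i, (i < n)%N ->
     (forall x, P i x -> P i.+1 x) /\ exists x, P i.+1 x /\ ~ P i x).

Definition krull_dim (n : nat) : Prop :=
  (exists P, prime_chain n P) /\
  forall m, (exists P, prime_chain m P) -> (m <= n)%N.

Definition regular_local : Prop :=
  noetherian /\ exists m : A -> Prop,
    [/\ is_maximal_ideal m,
        forall m', is_maximal_ideal m' -> forall x, m' x <-> m x &
        exists (n : nat) (e : 'I_n -> A),
          krull_dim n /\ forall x, m x <-> ideal_generated e x].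
End CommutativeAlgebra.

Definition multiplicative (A : comNzRingType) (S : A -> Prop) : Prop :=
  S 1 /\ forall x y, S x -> S y -> S (x * y).

Definition is_localization (A B : comNzRingType) (S : A -> Prop)
    (phi : A -> B) : Prop :=
  [/\ forall s, S s -> exists t, phi s * t = 1,
      forall b, exists a s, S s /\ phi s * b = phi a &
      forall a, phi a = 0 -> exists s, S s /\ s * a = 0].

(** A localisation is determined up to isomorphism by [is_localization], so any
    model [L] of [A_P] will do. *)
Definition regular_ring (A : comNzRingType) : Prop :=
  noetherian A /\
  forall P : A -> Prop, is_prime_ideal P ->
    exists (L : comNzRingType) (phi : {rmorphism A -> L}),
      is_localization (fun s => ~ P s) phi /\ regular_local L.

Definition finitely_generated_algebra (K : fieldType) (A : comAlgType K) : Prop :=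
  exists (n : nat) (e : 'I_n -> A), forall B : A -> Prop,
    (forall a : K, B a%:A) -> (forall x y, B x -> B y -> B (x + y)) ->
    (forall x y, B x -> B y -> B (x * y)) -> (forall i, B (e i)) ->
  forall x, B x.

Definition essentially_of_finite_type (K : fieldType) (R : comAlgType K) : Prop :=
  exists (A : comAlgType K) (S : A -> Prop) (phi : {lrmorphism A -> R}),
    [/\ finitely_generated_algebra A, multiplicative S &
        is_localization S phi].

(** Some maximal ideal [m] of [R] has a residue field [R/m] that is a finite
    extension of [K]; the latter is the target of a surjection with kernel [m]. *)
Definition has_finite_residue_field (K : fieldType) (R : comAlgType K) : Prop :=
  exists m : R -> Prop, is_maximal_ideal m /\
    exists (L : fieldExtType K) (phi : {lrmorphism R -> L}),
      (forall y, exists x, phi x = y) /\ (forall x, m x <-> phi x = 0).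

(* Main.v *)
(** Iterativity says that the part of the extended connection that raises
    degrees by [n] is the divided power [F ^ n / n!] of the part [F] that raises
    degrees by [1], and [F] is determined by the ordinary connection [nabla^(1)],
    because [Omega_1] is the module of Kaehler differentials. In characteristic
    zero every ordinary connection has such an extension [F], whose divided powers
    form an iterative connection.

    For integrability write [nabla_psi] as a series [N] in [T]. Every higher
    derivation [psi] satisfies [T d/dT psi = psi o D] for a series [D] of
    derivations, and iterativity lifts this to [T d/dT N = N o nabla_D]. This
    differential equation has a unique solution, so if [nabla^(1)] is integrable
    then [nabla_(psi1 psi2)] and [nabla_psi1 nabla_psi2] agree, both solving the
    equation for [psi1 psi2]. Conversely, for derivations [D1] and [D2] the
    coefficient of [T ^ 2] in the equation for [exp(D1 T) exp(D2 T)] gives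
    [[nabla_D1, nabla_D2] = nabla_[D1, D2]]. *)
Require Import Defs.
From HB Require Import structures.
From mathcomp Require Import all_boot all_algebra.
From mathcomp Require Import zify boolp.

Set Implicit Arguments.
Unset Strict Implicit.
Unset Printing Implicit Defensive.
Import GRing.Theory.
Local Open Scope ring_scope.

(** * Additive maps and torsion-free groups *)

Section Additive.
Variables (V W : zmodType) (f : V -> W) (fA : zmod_morphism f).

Definition additive_pack : {additive V -> W} :=
  HB.pack f (GRing.isZmodMorphism.Build V W f fA).

Lemma additive0 : f 0 = 0. Proof. exact: (raddf0 additive_pack). Qed.
Lemma additiveD x y : f (x + y) = f x + f y.
Proof. exact: (raddfD additive_pack). Qed.
Lemma additiveN x : f (- x) = - f x.
Proof. exact: (raddfN additive_pack). Qed.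
Lemma additiveMn x n : f (x *+ n) = f x *+ n.
Proof. exact: (raddfMn additive_pack). Qed.
Lemma additive_sum I (r : seq I) (P : pred I) (F : I -> V) :
  f (\sum_(i <- r | P i) F i) = \sum_(i <- r | P i) f (F i).
Proof. exact: (raddf_sum additive_pack). Qed.
End Additive.

Definition torsion_free (V : zmodType) : Prop :=
  forall n (x : V), x *+ n.+1 = 0 -> x = 0.

Lemma torsion_free_inj (V : zmodType) n (x y : V) :
  torsion_free V -> x *+ n.+1 = y *+ n.+1 -> x = y.
Proof.
move=> tfV /eqP; rewrite -subr_eq0 -mulrnBl => /eqP /tfV /eqP.
by rewrite subr_eq0 => /eqP.
Qed.

(** * Divided powers of an additive map *)

Section ExponentialSequences.
Implicit Types (U V W : zmodType).

(** [s n] plays the role of [D ^ n / n!]. *)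
Definition expseq V (D : V -> V) (s : nat -> V -> V) : Prop :=
  (forall x, s 0 x = x) /\ (forall n x, s n.+1 x *+ n.+1 = D (s n x)).

(** Multiplied by [n.+1], both sides at [n.+1] satisfy the same recursion, and the factor cancels in
    [W]. *)
Lemma expseq_intertwine V W (f : V -> W) D s D' s' :
    torsion_free W -> zmod_morphism f -> expseq D s -> expseq D' s' ->
  (forall x, f (D x) = D' (f x)) -> forall n x, f (s n x) = s' n (f x).
Proof.
move=> tfW fA [s0 sS] [s'0 s'S] fD; elim=> [|n IHn] x; first by rewrite s0 s'0.
by apply: (torsion_free_inj tfW (n := n)); rewrite -additiveMn // sS s'S fD IHn.
Qed.

(** Induction on [i]: after multiplication by [i.+1] the step is [(i + 1) 'C(i + j + 1, i + 1) = (i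
    + j + 1) 'C(i + j, i)]. This is the source of iterativity. *)
Lemma expseq_comp V (D : V -> V) s : torsion_free V -> zmod_morphism D ->
  expseq D s -> forall i j x, s i (s j x) = s (i + j) x *+ 'C(i + j, i).
Proof.
move=> tfV DA [s0 sS]; elim=> [|i IHi] j x; first by rewrite s0 bin0.
apply: (torsion_free_inj tfV (n := i)).
rewrite sS IHi additiveMn // addSn -sS -!mulrnA; congr (_ *+ _).
by have := mul_bin_diag (i + j).+1 i; rewrite /=; lia.
Qed.

(** The factor [n.+1] is split as [i + (n.+1 - i)]; in each half the term of weight zero drops out.
    This is the Leibniz rule for [d/dT] on coefficients. *)
Lemma sum_diagonal_mulrn V (G : nat -> nat -> V) n :
  (\sum_(i < n.+2) G i (n.+1 - i)%N) *+ n.+1 =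
  \sum_(i < n.+1) (G i.+1 (n - i)%N *+ i.+1 + G i (n - i).+1 *+ (n - i).+1).
Proof.
rewrite big_split /=.
transitivity (\sum_(i < n.+2) (G i (n.+1 - i)%N *+ i +
                               G i (n.+1 - i)%N *+ (n.+1 - i))).
  rewrite -sumrMnl; apply: eq_bigr => i _; rewrite -mulrnDr subnKC //.
  by rewrite -ltnS.
rewrite big_split /=; congr (_ + _).
  rewrite big_ord_recl mulr0n add0r; apply: eq_bigr => i _.
  by rewrite subSS.
rewrite big_ord_recr /= subnn mulr0n addr0; apply: eq_bigr => i _.
by rewrite subSn // -ltnS.
Qed.

(** Both sides obey the same recursion in [n], and division by [n.+1] is possible in [W]. It serves
    for the product of [R] and for the action of [Omega] on [Omega (x) M]. *)
Lemma expseq_leibniz U V W (b : U -> V -> W) DU p DV q DW s :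
    torsion_free W -> zmod_morphism DW ->
    (forall u, zmod_morphism (b u)) -> (forall v, zmod_morphism (b^~ v)) ->
    expseq DU p -> expseq DV q -> expseq DW s ->
    (forall u v, DW (b u v) = b (DU u) v + b u (DV v)) ->
  forall n u v, s n (b u v) = \sum_(i < n.+1) b (p i u) (q (n - i)%N v).
Proof.
move=> tfW DWA bAr bAl [p0 pS] [q0 qS] [s0 sS] DWb.
elim=> [|n IHn] u v; first by rewrite s0 big_ord1 p0 q0.
apply: (torsion_free_inj tfW (n := n)).
rewrite sS IHn (sum_diagonal_mulrn (fun i j => b (p i u) (q j v))).
rewrite additive_sum //; apply: eq_bigr => i _; rewrite DWb -pS -qS.
by rewrite additiveMn // (additiveMn (bAl _)).
Qed.

End ExponentialSequences.

(** * Formal series of endomorphisms *)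

Section Convolution.
Variable V : zmodType.
Implicit Types f g h P : nat -> V -> V.

(** The product and the Euler operator [T d/dT] for the formal series
    [sum_n f_n T^n] with coefficients in the endomorphisms of [V]. *)
Definition conv f g : nat -> V -> V :=
  fun n x => \sum_(i < n.+1) f (n - i)%N (g i x).
Definition euler f : nat -> V -> V := fun n x => f n x *+ n.
Definition conv_add f g : nat -> V -> V := fun n x => f n x + g n x.

Lemma convE f g n x : conv f g n x = \sum_(i < n.+1) f i (g (n - i)%N x).
Proof.
rewrite /conv (reindex_inj rev_ord_inj) /=; apply: eq_bigr => i _.
by rewrite subSS subKn // -ltnS.
Qed.

Lemma convA f g h : (forall n, zmod_morphism (f n)) ->
  conv f (conv g h) = conv (conv f g) h.
Proof.
move=> fA; apply/funext => n; apply/funext => x.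
transitivity (\sum_(i < n.+1) \sum_(j < i.+1)
   (fun a b c => f c (g b (h a x))) j (i - j)%N (n - i)%N).
  by apply: eq_bigr => i _; rewrite additive_sum.
by rewrite (sum_triangle n (fun a b c => f c (g b (h a x)))).
Qed.

Lemma conv_additive f g :
    (forall n, zmod_morphism (f n)) -> (forall n, zmod_morphism (g n)) ->
  forall n, zmod_morphism (conv f g n).
Proof.
move=> fA gA n x y; rewrite /conv -sumrB; apply: eq_bigr => i _.
by rewrite gA fA.
Qed.

Lemma conv_addr f g h : (forall n, zmod_morphism (f n)) ->
  conv f (conv_add g h) = conv_add (conv f g) (conv f h).
Proof.
move=> fA; apply/funext => n; apply/funext => x; rewrite /conv_add /conv -big_split.
by apply: eq_bigr => i _; rewrite additiveD.
Qed.

Lemma euler_conv f g : (forall n, zmod_morphism (f n)) ->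
  euler (conv f g) = conv_add (conv (euler f) g) (conv f (euler g)).
Proof.
move=> fA; apply/funext => n; apply/funext => x.
rewrite /conv_add /conv /euler -sumrMnl -big_split /=; apply: eq_bigr => i _.
by rewrite additiveMn // -mulrnDr subnK // -ltnS.
Qed.

(** Up to terms in lower coefficients of [f], coefficient [n] of [conv P f] is [f n], since [P 0] is
    the identity. *)
Lemma conv_cancel P f g : (forall n, zmod_morphism (P n)) ->
  (forall x, P 0 x = x) -> conv P f = conv P g -> f = g.
Proof.
move=> PA P0 fg; apply/funext; elim/ltn_ind => n IHn; apply/funext => x.
have /(congr1 (fun F => F n x)) := fg.
rewrite /conv !big_ord_recr /= subnn !P0.
rewrite (eq_bigr (fun i : 'I_n => P (n - i)%N (g i x))) => [/addrI //|i _].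
by rewrite IHn.
Qed.
End Convolution.

(** * Linear differential equations for such series *)

Section LinearDifferentialEquations.
Variables (V : zmodType) (tfV : torsion_free V).
Implicit Types P Q D X Y : nat -> V -> V.

Lemma conv_vanish P D n x : (forall n, zmod_morphism (P n)) ->
    (forall x, D 0 x = 0) ->
  conv P D n x = \sum_(i < n) P (n - i.+1)%N (D i.+1 x).
Proof. by move=> PA D0; rewrite /conv big_ord_recl D0 (additive0 (PA _)) add0r. Qed.

(** As [D 0] vanishes, the equation expresses [(n + 1) P_(n+1)] through [P_0, ..., P_n], and [V] has
    no torsion. *)
Lemma euler_uniq P Q D :
    (forall n, zmod_morphism (P n)) -> (forall n, zmod_morphism (Q n)) ->
    (forall x, P 0 x = Q 0 x) -> (forall x, D 0 x = 0) ->
    euler P = conv P D -> euler Q = conv Q D -> P = Q.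
Proof.
move=> PA QA PQ0 D0 eP eQ; apply/funext; elim/ltn_ind => -[_|n IHn].
  exact/funext.
apply/funext => x; apply: (torsion_free_inj tfV (n := n)).
rewrite -[LHS]/(euler P n.+1 x) -[RHS]/(euler Q n.+1 x) eP eQ !conv_vanish //.
by apply: eq_bigr => i _; rewrite subSS IHn // ltnS leq_subr.
Qed.

(** Both sides solve [euler Z = conv Z D] with initial value [c]. *)
Lemma comp_conv (c : V -> V) P D X :
    zmod_morphism c -> (forall n, zmod_morphism (P n)) ->
    (forall n, zmod_morphism (X n)) ->
    (forall x, P 0 x = x) -> (forall x, X 0 x = c x) -> (forall x, D 0 x = 0) ->
    euler P = conv P D -> conv_add (euler X) (conv D X) = conv X D ->
  (fun n x => c (P n x)) = conv P X.
Proof.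
move=> cA PA XA P0 X0 D0 eP eX; apply: (euler_uniq (D := D)) => //.
- by move=> n x y; rewrite PA cA.
- exact: conv_additive.
- by move=> x; rewrite P0 /conv big_ord1 P0 X0.
- apply/funext => n; apply/funext => x.
  by rewrite /euler -additiveMn // -[P n x *+ n]/(euler P n x) eP additive_sum.
- by rewrite euler_conv // eP -!convA // -eX conv_addr // /conv_add;
    apply/funext => n; apply/funext => x; rewrite addrC.
Qed.

(** The Euler operator yields [P D Q + P Q D']. Moving the coefficient [D b] to the right of [Q]
    turns it into the series [X b], and the [T^b X b] are summed over [b]. *)
Lemma euler_conv_conv P D Q D' (X : nat -> nat -> V -> V) :
    (forall n, zmod_morphism (P n)) -> (forall n, zmod_morphism (Q n)) ->
    euler P = conv P D -> euler Q = conv Q D' ->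
    (forall b, (fun n x => D b (Q n x)) = conv Q (X b)) ->
  euler (conv P Q) =
  conv (conv P Q)
    (conv_add (fun l x => \sum_(b < l.+1) X b (l - b)%N x) D').
Proof.
move=> PA QA eP eQ DQ; rewrite euler_conv // eP eQ.
rewrite conv_addr; last exact: conv_additive.
congr conv_add; last exact: convA.
rewrite -!convA //; congr conv; apply/funext => n; apply/funext => x.
rewrite convE.
pose F b k e := Q e (X b k x).
transitivity (\sum_(b < n.+1) \sum_(k < (n - b).+1) F b k (n - b - k)%N).
  by apply: eq_bigr => b _; rewrite -[RHS](congr1 (fun g => g (n - b)%N x) (DQ b)).
rewrite -sum_triangle; apply: eq_bigr => l _.
by rewrite additive_sum.
Qed.
End LinearDifferentialEquations.

(** Entry [n] of the iterates of [F] no longer changes after [n.+1] rounds, so these stable entries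
    form a fixed point. *)
Lemma causal_fixpoint (A : Type) (F : (nat -> A) -> nat -> A) (a0 : A) :
    (forall g h n, (forall i, (i < n)%N -> g i = h i) -> F g n = F h n) ->
  exists g, forall n, g n = F g n.
Proof.
move=> Fcausal; pose it k := iter k F (fun=> a0).
have stable n k : (n < k)%N -> it k n = it n.+1 n.
  elim/ltn_ind: n k => n IHn [//|k]; rewrite ltnS => le_nk.
  apply: Fcausal => i lt_in.
  by rewrite [LHS]IHn ?(leq_trans lt_in) // [RHS]IHn.
exists (fun n => it n.+1 n) => n; apply: Fcausal => i lt_in.
exact: stable.
Qed.

(** * Higher derivations and their logarithmic derivatives *)

Section HigherDerivations.
Variables (K : fieldType) (R : comAlgType K).
Implicit Types (psi : hder R) (D : kder R).

Definition hder_coef psi : nat -> R -> R := fun n r => psi r n.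

Lemma hder_coef_additive psi n : zmod_morphism (hder_coef psi n).
Proof. by move=> r s; rewrite /hder_coef rmorphB. Qed.

Lemma hder_coef0 psi r : hder_coef psi 0 r = r. Proof. exact: hder0. Qed.

Lemma kder_additive D : zmod_morphism D. Proof. exact: raddfB. Qed.

Lemma hder_ext_fpsC psi r : hder_ext psi (fpsC r) = psi r.
Proof.
apply/funext => n; rewrite /hder_ext big_ord_recl big1 ?addr0 ?subn0 // => i _.
by rewrite /fpsC rmorph0 fps0E.
Qed.

(** Since [psi^(0)] is the identity, [psi[[T]]] is unitriangular in the coefficients. *)
Lemma hder_ext_inj psi : injective (hder_ext psi).
Proof.
move=> f g fg; apply/funext; elim/ltn_ind => n IHn.
have /(congr1 (fun h => h n)) := fg; rewrite /hder_ext !big_ord_recr /= subnn.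
rewrite !hder0 (eq_bigr (fun i : 'I_n => psi (g i) (n - i)%N)) => [/addrI //|i _].
by rewrite IHn.
Qed.

(** The unitriangular system is solved for [g] one coefficient at a time. *)
Lemma hder_ext_surj psi f : exists g, hder_ext psi g = f.
Proof.
have [|g gE] := @causal_fixpoint R
  (fun g n => f n - \sum_(i < n) psi (g i) (n - i)%N) 0.
  by move=> g h n gh; congr (_ - _); apply: eq_bigr => i _; rewrite gh.
exists g; apply/funext => n.
by rewrite /hder_ext big_ord_recr /= subnn hder0 addrC gE subrK.
Qed.

(** A derivation [theta] along [psi] is [psi[[T]]] composed with a derivation
    [R -> R[[T]]], because [psi[[T]]] is bijective. *)
Lemma hder_derivation_factor psi (theta : R -> fps R) :
    zmod_morphism theta -> (forall a : K, theta a%:A = 0) ->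
    (forall r s, theta (r * s) = psi r * theta s + psi s * theta r) ->
  exists X : nat -> kder R, forall r n, theta r n = conv (hder_coef psi) X n r.
Proof.
move=> thetaB thetaK thetaM.
have [x xE] := choice (fun r => hder_ext_surj psi (theta r)).
have xB : zmod_morphism x.
  by move=> r s; apply: (@hder_ext_inj psi); rewrite rmorphB /= !xE thetaB.
have xM r s : x (r * s) = fpsC r * x s + fpsC s * x r.
  apply: (@hder_ext_inj psi).
  by rewrite rmorphD !rmorphM /= !xE !hder_ext_fpsC thetaM.
have xK (a : K) : x a%:A = 0.
  by apply: (@hder_ext_inj psi); rewrite xE thetaK rmorph0.
have xnM n r s : x (r * s) n = r * x s n + s * x r n.
  by rewrite xM fpsDE [X in X + _]fpsC_mul [X in _ + X]fpsC_mul.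
have xnB n : zmod_morphism (fun r => x r n) by move=> r s; rewrite xB.
have xnZ n : scalable (fun r => x r n).
  move=> a r; rewrite -[a *: r]mulr_algl xnM xK fps0E mulr0 addr0.
  by rewrite mulr_algl.
pose X0 n : {linear R -> R} := HB.pack (fun r => x r n)
  (GRing.isZmodMorphism.Build R R _ (xnB n))
  (GRing.isScalable.Build K R R *:%R _ (xnZ n)).
exists (fun n => @KDer K R (X0 n) (xnM n)) => r n.
by rewrite -xE.
Qed.

(** [T d/dT] is a derivation of [R[[T]]], so its composite with [psi] is a derivation along [psi]
    and factors. *)
Lemma euler_hder psi :
  exists D : nat -> kder R, euler (hder_coef psi) = conv (hder_coef psi) D.
Proof.
have [||r s|D DE] := @hder_derivation_factor psi (fun r n => psi r n *+ n).
- move=> r s; apply/funext => n.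
  by rewrite rmorphB fpsBE mulrnBl.
- move=> a; apply/funext => -[|n]; first by rewrite mulr0n fps0E.
  by rewrite hderK fps0E /fpsC mul0rn.
- apply/funext => n; rewrite rmorphM fpsDE !fpsME -sumrMnl.
  rewrite [X in _ = _ + X](reindex_inj rev_ord_inj) -big_split /=.
  apply: eq_bigr => i _; have le_in : (i <= n)%N by rewrite -ltnS.
  rewrite subSS subKn // !mulrnAr [psi s _ * _]mulrC -mulrnDr.
  by rewrite subnK.
exists D; apply/funext => n; apply/funext => r; exact: DE.
Qed.

(** Applying [D] to each coefficient is a derivation of [R[[T]]], so its composite with [psi]
    factors too. This moves a derivation to the right of [psi]. *)
Lemma comp_hder D psi :
  exists X : nat -> kder R,
    (fun n r => D (hder_coef psi n r)) = conv (hder_coef psi) X.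
Proof.
have [||r s|X XE] := @hder_derivation_factor psi (fun r n => D (psi r n)).
- by move=> r s; apply/funext => n; rewrite rmorphB fpsBE raddfB.
- move=> a; apply/funext => n; rewrite hderK fps0E /fpsC.
  by case: (n == 0); rewrite ?kderK ?raddf0.
- apply/funext => n; rewrite rmorphM fpsDE !fpsME raddf_sum.
  rewrite [X in _ = _ + X](reindex_inj rev_ord_inj) -big_split /=.
  apply: eq_bigr => i _; have le_in : (i <= n)%N by rewrite -ltnS.
  by rewrite subSS subKn // kderM.
exists X; apply/funext => n; apply/funext => r; exact: XE.
Qed.

Lemma conv_hder_comp psi1 psi2 :
  hder_coef (hder_comp psi1 psi2) = conv (hder_coef psi1) (hder_coef psi2).
Proof. by []. Qed.

Section CharacteristicZero.
Hypothesis K_char0 : [pchar K] =i pred0.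

Definition inv_nat n : R := (n.+1%:R^-1 : K)%:A.

Lemma inv_natK (V : lmodType R) n (x : V) : (inv_nat n *: x) *+ n.+1 = x.
Proof.
rewrite -scaler_nat scalerA /inv_nat -(rmorph_nat (GRing.in_alg R)) -rmorphM /=.
rewrite mulfV ?scale1r //.
by have /pcharf0P -> := K_char0.
Qed.

Lemma lmod_torsion_free (V : lmodType R) : torsion_free V.
Proof.
by move=> n x; rewrite -{2}(inv_natK n x) scalerMnr => ->; rewrite scaler0.
Qed.

Lemma alg_torsion_free : torsion_free R.
Proof. exact: (@lmod_torsion_free R^o). Qed.

Fixpoint divpow (V : lmodType R) (D : V -> V) (n : nat) (x : V) : V :=
  if n is m.+1 then inv_nat m *: D (divpow D m x) else x.

Lemma divpow_expseq (V : lmodType R) (D : V -> V) : expseq D (divpow D).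
Proof. by split=> // n x; rewrite inv_natK. Qed.

Lemma divpow_additive (V : lmodType R) (D : V -> V) n :
  zmod_morphism D -> zmod_morphism (divpow D n).
Proof. by move=> DB; elim: n => [//|n IHn] x y; rewrite /= IHn DB scalerBr. Qed.

(** The witness is [exp (D T)]: multiplicative by [expseq_leibniz], and constant on [K] because [D]
    kills [K]. *)
Lemma kder_exp D : exists psi, expseq D (hder_coef psi).
Proof.
pose s := @divpow R^o D; have sP : expseq D s := divpow_expseq (D : R^o -> R^o).
have sB n : zmod_morphism (s n) by exact/divpow_additive/kder_additive.
pose f r : fps R := fun n => s n r.
have sM n r t : s n (r * t) = \sum_(i < n.+1) s i r * s (n - i)%N t.
  apply: (@expseq_leibniz R R R *%R D s D s D s).
  - exact: alg_torsion_free.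
  - exact: kder_additive.
  - by move=> u x y; rewrite mulrBr.
  - by move=> u x y; rewrite mulrBl.
  - exact: sP.
  - exact: sP.
  - exact: sP.
  - by move=> u v; rewrite kderM addrC [v * _]mulrC.
have sK n (a : K) : s n.+1 a%:A = 0.
  apply: (@alg_torsion_free n); elim: n => [|n IHn]; rewrite (proj2 sP).
    by rewrite (proj1 sP) kderK.
  by rewrite (alg_torsion_free IHn) raddf0.
have fK (a : K) : f a%:A = fpsC a%:A.
  by apply/funext => -[|n] //; rewrite /f sK.
have fB : zmod_morphism f by move=> r t; apply/funext => n; rewrite fpsBE -sB.
have fM : monoid_morphism f.
  split; last by move=> r t; apply/funext => n; exact: sM.
  by have := fK 1; rewrite scale1r.
pose F : {rmorphism R -> fps R} := HB.pack f
  (GRing.isZmodMorphism.Build R (fps R) f fB)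
  (GRing.isMonoidMorphism.Build R (fps R) f fM).
by exists (@HDer K R F fK (fun=> erefl)).
Qed.
End CharacteristicZero.
End HigherDerivations.

(** * Square-zero extensions *)

Section TrivialExtension.
Variables (A : comNzRingType) (V : lmodType A).

(** [A + V] with [V ^ 2 = 0] *)
Definition trivial_ext : Type := (A * V)%type.
HB.instance Definition _ := GRing.Zmodule.on trivial_ext.
Implicit Types x y z : trivial_ext.

Definition te_mul x y : trivial_ext := (x.1 * y.1, x.1 *: y.2 + y.1 *: x.2).

Lemma te_mulA : associative te_mul.
Proof.
move=> x y z; rewrite /te_mul /= mulrA !scalerDr !scalerA addrA.
by rewrite (mulrC z.1 x.1) (mulrC z.1 y.1).
Qed.
Lemma te_mulC : commutative te_mul.
Proof. by move=> x y; rewrite /te_mul mulrC addrC. Qed.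
Lemma te_mul1 : left_id ((1, 0) : trivial_ext) te_mul.
Proof. by case=> a v; rewrite /te_mul /= mul1r scale1r scaler0 addr0. Qed.
Lemma te_mulDl : left_distributive te_mul +%R.
Proof.
case=> [a u] [b v] [c w]; congr pair => /=; first exact: mulrDl.
by rewrite scalerDl scalerDr addrACA.
Qed.
Lemma te_1neq0 : ((1, 0) : trivial_ext) != 0.
Proof. by apply/eqP => -[/eqP]; rewrite oner_eq0. Qed.

HB.instance Definition _ := GRing.Zmodule_isComNzRing.Build trivial_ext
  te_mulA te_mulC te_mul1 te_mulDl te_1neq0.

Lemma te_mulE x y : x * y = (x.1 * y.1, x.1 *: y.2 + y.1 *: x.2).
Proof. by []. Qed.
End TrivialExtension.

(** * Functoriality of the tensor product in its left factor *)

Section TensorMapLeft.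
Variables (R : comNzRingType) (V W M : lmodType R) (f : {linear V -> W}).

Lemma tmapl_balanced : balanced (fun v (m : M) => pure (f v) m).
Proof.
split=> [v w m|v m n|r v m]; first by rewrite raddfD pureDl.
- exact: pureDr.
- by rewrite linearZ pureZ.
Qed.

Definition tmapl : tensor V M -> tensor W M := tlift tmapl_balanced.
HB.instance Definition _ := GRing.Additive.on tmapl.

Lemma tmapl_pure v m : tmapl (pure v m) = pure (f v) m.
Proof. exact: tlift_pure. Qed.

Lemma tmapl_is_scalable : scalable tmapl.
Proof.
move=> r; elim/tensor_ind => [v m||x y IHx IHy|x IHx].
- by rewrite pure_scale !tmapl_pure linearZ pure_scale.
- by rewrite scaler0 raddf0 scaler0.
- by rewrite scalerDr !raddfD /= IHx IHy.
- by rewrite scalerN !raddfN /= IHx.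
Qed.
HB.instance Definition _ :=
  GRing.isScalable.Build R (tensor V M) (tensor W M) *:%R tmapl tmapl_is_scalable.

Lemma tmapl_D x y : tmapl (x + y) = tmapl x + tmapl y. Proof. exact: raddfD. Qed.
Lemma tmapl_Z r x : tmapl (r *: x) = r *: tmapl x. Proof. exact: linearZ. Qed.
End TensorMapLeft.

Section TensorMaps.
Variables (R : comNzRingType) (V W M N : lmodType R).

Lemma pure0l (m : M) : pure (0 : V) m = 0.
Proof. by apply: (addrI (pure 0 m)); rewrite -pureDl !addr0. Qed.

Lemma tmapl_tmap (f : {linear V -> W}) (g : {linear M -> N}) (x : tensor V M) :
  tmapl f (tmap g x) = tmap g (tmapl f x).
Proof.
elim/tensor_ind: x => [v m||x y IHx IHy|x IHx].
- by rewrite !(tmapl_pure, tmap_pure).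
- by rewrite !raddf0.
- by rewrite !raddfD /= IHx IHy.
- by rewrite !raddfN /= IHx.
Qed.
End TensorMaps.

(** * Kaehler differentials as the degree-one part of [Omega] *)

Section DegreeOne.
Variables (K : fieldType) (R : comAlgType K).

Section KahlerLift.
Variables (W : lmodType R) (d : R -> W).
Hypotheses (dD : forall r s, d (r + s) = d r + d s).
Hypotheses (dK : forall a : K, d a%:A = 0).
Hypotheses (dM : forall r s, d (r * s) = r *: d s + s *: d r).

Fixpoint kterm_eval (t : kterm R) : W :=
  match t with
  | KGen r => d r
  | KZero => 0
  | KAdd t u => kterm_eval t + kterm_eval u
  | KOpp t => - kterm_eval t
  | KScale r t => r *: kterm_eval t
  end.

Lemma kterm_eval_eq t u : keq t u -> kterm_eval t = kterm_eval u.
Proof.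
elim=> {t u} //=.
- by move=> t u v _ -> _ ->.
- by move=> t t' u u' _ -> _ ->.
- by move=> t t' _ ->.
- by move=> r t t' _ ->.
- by move=> t u v; apply: addrA.
- by move=> t u; apply: addrC.
- by move=> t; apply: add0r.
- by move=> t; apply: addNr.
- by move=> r s t; apply: scalerA.
- by move=> t; apply: scale1r.
- by move=> r t u; apply: scalerDr.
- by move=> r s t; apply: scalerDl.
Qed.

(** The universal property for derivations into an arbitrary module; [klift] covers only those of
    [R] into itself. *)
Lemma kahler_lift : exists f : {linear kahler R -> W}, forall r, f (kd r) = d r.
Proof.
pose f (x : kahler R) := kterm_eval (rep x).
have fE t : f (cls (k_eqv R) t) = kterm_eval t.
  exact/kterm_eval_eq/(rep_cls (k_eqv R)).
have fB : zmod_morphism f.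
  move=> x y; case: (clsP x) (clsP y) => t -> [u ->].
  have -> : (cls (k_eqv R) t : kahler R) - (cls (k_eqv R) u : kahler R) =
      cls (k_eqv R) (KAdd t (KOpp u)) by rewrite -k_addE -k_oppE.
  by rewrite !fE.
have fZ : scalable f.
  by move=> r x; case: (clsP x) => t ->; rewrite [_ *: _]k_scaleE !fE.
pose F : {linear kahler R -> W} := HB.pack f
  (GRing.isZmodMorphism.Build _ _ f fB) (GRing.isScalable.Build _ _ _ *:%R f fZ).
by exists F => r; apply: fE.
Qed.
End KahlerLift.

Lemma kahler_hd_exists :
  exists f : {linear kahler R -> hdiff R}, forall r, f (kd r) = hd 1 r.
Proof.
apply: kahler_lift => [r s|a|r s]; [exact: hdD|exact: hdK|].
by rewrite hdM big_ord_recl big_ord1 !hd_scaleE [hd _ r * hd 0 s]mulrC.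
Qed.

(** Inverse isomorphisms between [Omega_(R/K)] and the part of degree [1] of
    [Omega]. *)
Definition kahler_hd : {linear kahler R -> hdiff R} :=
  projT1 (cid kahler_hd_exists).

Lemma kahler_hd_kd r : kahler_hd (kd r) = hd 1 r.
Proof. exact: (projT2 (cid kahler_hd_exists)). Qed.

(** The truncation of [Omega] that kills all degrees above one; products of two elements of degree
    one vanish, hence the square-zero target. *)
Definition hd_trunc (k : nat) (r : R) : trivial_ext (kahler R) :=
  match k with 0 => (r, 0) | 1 => (0, kd r) | _ => 0 end.

Lemma hd_trunc_compat : hdcompat hd_trunc.
Proof.
split=> //.
- case=> [|[|k]] r s /=; first by congr pair; rewrite addr0.
    by rewrite kdD; congr pair; rewrite addr0.
  by rewrite addr0.
- by case=> [//|[|//]] a _ /=; rewrite kdK.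
- case=> [|[|k]] r s.
  + by rewrite big_ord1 te_mulE /= !scaler0 addr0.
  + rewrite big_ord_recl big_ord1 /= !te_mulE /= kdM.
    by congr pair; rewrite ?mulr0 ?mul0r ?scaler0 ?scale0r ?addr0 ?add0r.
  + rewrite [LHS]/= big1 // => -[[|[|i]] lt_i] _; [exact: mulr0| |exact: mul0r].
    case: k lt_i => [|k] lt_i; last exact: mulr0.
    rewrite -[LHS]/(te_mul (0, kd r) (0, kd s)) /te_mul /=.
    by rewrite mul0r !scale0r addr0.
Qed.

Definition hd1_kahler_fun (w : hdiff R) : kahler R :=
  (hdlift hd_trunc_compat w).2.

Lemma hd1_kahler_is_zmod_morphism : zmod_morphism hd1_kahler_fun.
Proof. by move=> v w; rewrite /hd1_kahler_fun rmorphB. Qed.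
Lemma hd1_kahler_is_scalable : scalable hd1_kahler_fun.
Proof.
move=> r w; rewrite /hd1_kahler_fun hd_scaleE rmorphM /= hdlift_hd /=.
by rewrite scaler0 addr0.
Qed.
Definition hd1_kahler : {linear hdiff R -> kahler R} := HB.pack hd1_kahler_fun
  (GRing.isZmodMorphism.Build _ _ _ hd1_kahler_is_zmod_morphism)
  (GRing.isScalable.Build _ _ _ *:%R _ hd1_kahler_is_scalable).

Lemma hd1_kahler_hd r : hd1_kahler (hd 1 r) = kd r.
Proof. by rewrite /= /hd1_kahler_fun hdlift_hd. Qed.

Lemma kahler_hdK : cancel kahler_hd hd1_kahler.
Proof.
elim/kahler_ind => [r||x y IHx IHy|r x IHx].
- by rewrite kahler_hd_kd hd1_kahler_hd.
- by rewrite !raddf0.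
- by rewrite !raddfD; congr (_ + _).
- by rewrite !linearZ; congr (_ *: _).
Qed.

(** A product of degree one has factors of degrees [0] and [1], so the induction on [hdeg] must also
    track degree zero, where an element is its scalar part [p x]. *)
Lemma hd1_kahlerK w : hdeg 1 w -> kahler_hd (hd1_kahler w) = w.
Proof.
pose p (x : hdiff R) := (hdlift hd_trunc_compat x).1.
suff H k x : hdeg k x -> (k = 0 -> x = hd 0 (p x)) /\
    (k = 1 -> p x = 0 /\ kahler_hd (hd1_kahler x) = x) by move=> /H[_ []].
rewrite /= /hd1_kahler_fun /p; elim=> {k x}.
- by move=> k r; split=> ->; rewrite hdlift_hd //= kahler_hd_kd.
- by move=> k; rewrite rmorph0 /= raddf0 hd00.
- move=> k x y _ [x0 x1] _ [y0 y1]; split=> kE; rewrite rmorphD /=.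
    by rewrite hdD -x0 // -y0.
  by case: x1 y1 => // -> x1 [//|-> y1]; rewrite addr0 raddfD /= x1 y1.
- move=> k x _ [x0 x1]; split=> kE; rewrite rmorphN /=.
    by rewrite hd0E scaleNr -hd0E -x0.
  by case: x1 => // -> x1; rewrite oppr0 raddfN /= x1.
move=> i j x y _ [x0 x1] _ [y0 y1]; split=> kE; rewrite rmorphM /=.
  have [i0 j0] : i = 0 /\ j = 0 by lia.
  by rewrite hd0M -x0 // -y0.
have {kE} [[i0 j1]|[i1 j0]] : i = 0 /\ j = 1 \/ i = 1 /\ j = 0 by lia.
  have [py yE] := y1 j1; rewrite py mulr0 scale0r addr0 linearZ /= yE; split=> //.
  by rewrite hd_scaleE -x0.
have [px xE] := x1 i1; rewrite px mul0r scale0r add0r linearZ /= xE; split=> //.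
by rewrite hd_scaleE -y0 // mulrC.
Qed.
End DegreeOne.

(** * Connections extended to [Omega (x) M] *)

Section ConnectionExtension.
Variables (K : fieldType) (R : comAlgType K).

Lemma dOmega_additive j : zmod_morphism (@dOmega_ K R j).
Proof. by move=> v w; rewrite /dOmega_ rmorphB. Qed.

Lemma dOmega_0 (w : hdiff R) : dOmega_ 0 w = w.
Proof.
elim/hdiff_ind: w => [k r|x y IHx IHy|x IHx|x y IHx IHy].
- by rewrite dOmega_hd addn0 bin0.
- by rewrite dOmega_D IHx IHy.
- by rewrite (additiveN (dOmega_additive _)) IHx.
- by rewrite dOmega_M big_ord1 IHx IHy.
Qed.

Lemma dOmega_1M (v w : hdiff R) :
  dOmega_ 1 (v * w) = dOmega_ 1 v * w + v * dOmega_ 1 w.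
Proof. by rewrite dOmega_M big_ord_recl big_ord1 /= !dOmega_0 addrC. Qed.

(** So [d_Omega] is the exponential of its part of degree one. On generators this is [(n + 1) 'C(k +
    n + 1, n + 1) = (k + n + 1) 'C(k + n, n)]; products follow from the Leibniz rule. *)
Lemma dOmega_expseq : expseq (@dOmega_ K R 1) (@dOmega_ K R).
Proof.
split=> [w|n w]; first exact: dOmega_0.
elim/hdiff_ind: w n => [k r|x y IHx IHy|x IHx|x y IHx IHy] n.
- rewrite !dOmega_hd additiveMn ?dOmega_hd; last exact: dOmega_additive.
  rewrite addn1 addnS -!mulrnA; congr (_ *+ _).
  by have := mul_bin_diag (k + n).+1 n; rewrite bin1 /=; lia.
- by rewrite !dOmega_D mulrnDl IHx IHy.
- by rewrite !(additiveN (@dOmega_additive _)) mulNrn IHx.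
- rewrite !dOmega_M (sum_diagonal_mulrn (fun i j => dOmega_ i x * dOmega_ j y)).
  rewrite (additive_sum (@dOmega_additive 1)); apply: eq_bigr => i _.
  by rewrite dOmega_1M -IHx -IHy mulrnAl mulrnAr.
Qed.

Section Module.
Variable M : lmodType R.
Implicit Types (c : conn M) (N : hconn M) (x : tensor (hdiff R) M).

Lemma hact_additive (w : hdiff R) : zmod_morphism (@hact K R M w).
Proof. by move=> x y; rewrite raddfB. Qed.

Lemma hact_additivel x : zmod_morphism (fun w : hdiff R => hact w x).
Proof.
by move=> v w; apply/eqP; rewrite eq_sym subr_eq -hactD subrK.
Qed.

Lemma hact_scale (r : R) x : hact (hd 0 r) x = r *: x.
Proof.
elim/tensor_ind: x => [v m||x y IHx IHy|x IHx].
- by rewrite hact_pure pure_scale hd_scaleE.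
- by rewrite hact_r0 scaler0.
- by rewrite hact_rD IHx IHy scalerDr.
- by rewrite hact_rN IHx scalerN.
Qed.

Lemma hact1 x : hact 1 x = x.
Proof. by rewrite -hd01 hact_scale scale1r. Qed.

Lemma tdeg_scale k (r : R) x : tdeg k x -> tdeg k (r *: x).
Proof. by rewrite -hact_scale => /(tdeg_hact (hdeg_gen 0 r)). Qed.

Lemma tdeg1_kahler (y : tensor (kahler R) M) : tdeg 1 (tmapl (kahler_hd R) y).
Proof.
elim/tensor_ind: y => [v m||x y IHx IHy|x IHx].
- rewrite tmapl_pure; apply: tdeg_pure.
  elim/kahler_ind: v => [r||x y IHx IHy|r x IHx].
  + by rewrite kahler_hd_kd; apply: hdeg_gen.
  + by rewrite raddf0; apply: hdeg0.
  + by rewrite raddfD; apply: hdegD.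
  + by rewrite linearZ; apply: (hdegM (hdeg_gen 0 r)).
- by rewrite raddf0; apply: tdeg0.
- by rewrite raddfD; apply: tdegD.
- by rewrite raddfN; apply: tdegN.
Qed.

Lemma tdeg1_kahlerK x :
  tdeg 1 x -> tmapl (kahler_hd R) (tmapl (hd1_kahler R) x) = x.
Proof.
have [k kE] : {k | k = 1%N} by exists 1%N.
rewrite -{1}kE => kx; elim: kx kE => {k x}.
- by move=> k w m kw k1; rewrite !tmapl_pure hd1_kahlerK // -k1.
- by move=> k _; rewrite !raddf0.
- by move=> k x y _ IHx _ IHy k1; rewrite !raddfD; congr (_ + _); auto.
- by move=> k x _ IHx k1; rewrite !raddfN; congr (- _); auto.
Qed.

Lemma tmapl_kahlerK (y : tensor (kahler R) M) :
  tmapl (hd1_kahler R) (tmapl (kahler_hd R) y) = y.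
Proof.
elim/tensor_ind: y => [v m||x y IHx IHy|x IHx].
- by rewrite !tmapl_pure kahler_hdK.
- by rewrite !raddf0.
- by rewrite !raddfD; congr (_ + _).
- by rewrite !raddfN; congr (- _).
Qed.

Section OfHigherConnection.
Variable N : hconn M.

Definition conn_of_hconn_fun (m : M) : tensor (kahler R) M :=
  tmapl (hd1_kahler R) (N m 1).

Lemma conn_of_hconnD m n :
  conn_of_hconn_fun (m + n) = conn_of_hconn_fun m + conn_of_hconn_fun n.
Proof. by rewrite /conn_of_hconn_fun nablaD raddfD. Qed.

Lemma conn_of_hconnZ r m :
  conn_of_hconn_fun (r *: m) = pure (kd r) m + r *: conn_of_hconn_fun m.
Proof.
rewrite /conn_of_hconn_fun nablaZ /= big_ord_recl big_ord1 /= nabla0.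
rewrite hact_pure mulr1 hact_scale raddfD addrC; congr (_ + _).
  by rewrite [LHS]tmapl_pure hd1_kahler_hd.
exact: linearZ.
Qed.

Lemma conn_of_hconnK (a : K) m :
  conn_of_hconn_fun (a%:A *: m) = a%:A *: conn_of_hconn_fun m.
Proof. by rewrite conn_of_hconnZ kdK pure0l add0r. Qed.

Definition conn_of_hconn : conn M :=
  Conn conn_of_hconnD conn_of_hconnK conn_of_hconnZ.
End OfHigherConnection.

Section Extension.
Variable c : conn M.

(** The term [d^(1) r] from differentiating [r *: v] matches the term [kd r] in the Leibniz rule of
    [c]. *)
Lemma conn_ext_balanced : balanced (fun (w : hdiff R) (m : M) =>
  pure (dOmega_ 1 w) m + hact w (tmapl (kahler_hd R) (c m))).
Proof.
split=> [v w m|v m n|r v m].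
- by rewrite dOmega_D pureDl hactD addrACA.
- by rewrite pureDr connD raddfD hact_rD addrACA.
rewrite connZ tmapl_D tmapl_Z tmapl_pure kahler_hd_kd hact_rD hact_pure.
rewrite -pureZ !hd_scaleE dOmega_1M dOmega_hd mulr1n pureDl.
rewrite [X in X + _]addrC -addrA; congr (_ + (_ + _)); first by rewrite mulrC.
by rewrite -hact_scale -hactM mulrC.
Qed.

(** The extension of [c] to [Omega (x) M] as a derivation over [d_Omega^(1)];
    on the [Omega (x) M] of an iterative connection it is the part of the
    extended connection that raises degrees by [1]. *)
Definition conn_ext : tensor (hdiff R) M -> tensor (hdiff R) M :=
  tlift conn_ext_balanced.
HB.instance Definition _ := GRing.Additive.on conn_ext.

Lemma conn_ext_pure w m :
  conn_ext (pure w m) = pure (dOmega_ 1 w) m + hact w (tmapl (kahler_hd R) (c m)).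
Proof. exact: tlift_pure. Qed.

Lemma conn_ext_additive : zmod_morphism conn_ext.
Proof. by move=> x y; rewrite raddfB. Qed.

Lemma conn_ext_hact w x :
  conn_ext (hact w x) = hact (dOmega_ 1 w) x + hact w (conn_ext x).
Proof.
elim/tensor_ind: x => [v m||x y IHx IHy|x IHx].
- rewrite hact_pure !conn_ext_pure dOmega_1M pureDl -addrA hact_rD !hact_pure.
  by rewrite hactM.
- by rewrite !raddf0 addr0.
- by rewrite !raddfD /= IHx IHy addrACA.
- by rewrite !raddfN /= IHx -opprD.
Qed.

Lemma conn_ext_deg k x : tdeg k x -> tdeg k.+1 (conn_ext x).
Proof.
elim=> {k x} [k w m kw|k|k x y _ IHx _ IHy|k x _ IHx].
- rewrite conn_ext_pure -addn1; apply: tdegD.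
    exact/tdeg_pure/dOmega_deg.
  exact/tdeg_hact/tdeg1_kahler.
- by rewrite raddf0; apply: tdeg0.
- by rewrite raddfD; apply: tdegD.
- by rewrite raddfN; apply: tdegN.
Qed.
End Extension.

(** Only [j = 0] and [j = 1] occur, where [d_Omega^(0)] and [nabla^(0)] are trivial; [nabla^(1)] is
    recovered from its Kaehler form. *)
Lemma ext_nabla1 N x : ext_nabla N 1 x = conn_ext (conn_of_hconn N) x.
Proof.
elim/tensor_ind: x => [v m||x y IHx IHy|x IHx].
- rewrite ext_nabla_pure conn_ext_pure big_ord_recl big_ord1 /= nabla0.
  rewrite dOmega_0 hact_pure mulr1 addrC tdeg1_kahlerK //.
  exact: coefsP.
- by rewrite !raddf0.
- by rewrite !raddfD /= IHx IHy.
- by rewrite !raddfN /= IHx.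
Qed.

Section CharacteristicZero.
Hypothesis K_char0 : [pchar K] =i pred0.
Let tfT : torsion_free (tensor (hdiff R) M) := lmod_torsion_free K_char0 (V := _).

Section OfConnection.
Variable c : conn M.
Let s := divpow (conn_ext c).
Let sP : expseq (conn_ext c) s := divpow_expseq K_char0 (conn_ext c).

Lemma divpow_conn_ext_hact n w x :
  s n (hact w x) = \sum_(i < n.+1) hact (dOmega_ i w) (s (n - i) x).
Proof.
apply: (expseq_leibniz tfT _ _ _ dOmega_expseq sP sP).
- exact: conn_ext_additive.
- exact: hact_additive.
- exact: hact_additivel.
- exact: conn_ext_hact.
Qed.

Lemma divpow_conn_ext_pure n w m :
  s n (pure w m) = \sum_(i < n.+1) hact (dOmega_ i w) (s (n - i) (pure 1 m)).
Proof. by rewrite -divpow_conn_ext_hact hact_pure mulr1. Qed.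

Lemma hconn_of_conn_deg m k : tdeg k (s k (pure 1 m)).
Proof.
elim: k => [|k IHk]; first exact/tdeg_pure/(hdeg_gen 0 1).
exact/tdeg_scale/conn_ext_deg.
Qed.

(** The series [exp (F) (1 (x) m)] for [F = conn_ext c], split by degree. *)
Definition hconn_of_conn_fun (m : M) : hOmegaM M :=
  Completion (hconn_of_conn_deg m).

Lemma hconn_of_connD m n k : hconn_of_conn_fun (m + n) k =
  hconn_of_conn_fun m k + hconn_of_conn_fun n k.
Proof.
rewrite -[LHS]/(s k (pure 1 (m + n))) pureDr.
exact/additiveD/divpow_additive/conn_ext_additive.
Qed.

(** Here [1 (x) r m = r (x) m], and [d_Omega] restricts to [d_R] on [R], so the Leibniz rule for
    divided powers applies. *)
Lemma hconn_of_connZ r m :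
  hconn_of_conn_fun (r *: m) = hactc (d_R r) (hconn_of_conn_fun m).
Proof.
apply: completion_eq => k.
rewrite -[LHS]/(s k (pure 1 (r *: m))) -pureZ hd_scaleE mulr1.
by rewrite divpow_conn_ext_pure; apply: eq_bigr => i _; rewrite dOmega_hd add0n binn.
Qed.

Definition hconn_of_conn : hconn M :=
  HConn hconn_of_connD hconn_of_connZ (fun=> erefl).

Lemma ext_nabla_hconn_of_conn n x : ext_nabla hconn_of_conn n x = s n x.
Proof.
have sA : zmod_morphism (s n) by exact/divpow_additive/conn_ext_additive.
elim/tensor_ind: x => [v m||x y IHx IHy|x IHx].
- by rewrite ext_nabla_pure divpow_conn_ext_pure.
- by rewrite raddf0 (additive0 sA).
- by rewrite raddfD (additiveD sA) -IHx -IHy.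
- by rewrite raddfN (additiveN sA) -IHx.
Qed.

(** Components with [k < i + j] vanish on both sides; the others are [expseq_comp] for the divided
    powers of [conn_ext c]. *)
Lemma hconn_of_conn_iterative : iterative hconn_of_conn.
Proof.
move=> i j u k /=; case: (leqP (i + j) k) => ijk; last first.
  rewrite mul0rn; case: (leqP i k) => ik //.
  by case: leqP => [jk|_]; [lia|rewrite raddf0].
have -> : (i <= k)%N by lia. have -> : (j <= k - i)%N by lia.
rewrite !ext_nabla_hconn_of_conn (expseq_comp tfT (conn_ext_additive c) sP).
by rewrite subnDA.
Qed.

(** [F (1 (x) m)] has the single term [c m], because [d^(1) 1 = 0]. *)
Lemma conn_of_hconn_of_conn m : conn_of_hconn hconn_of_conn m = c m.
Proof.
rewrite /= /conn_of_hconn_fun /= -/(s 1 _).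
have [_ sS] := sP; have := sS 0 (pure 1 m); rewrite mulr1n => ->.
rewrite conn_ext_pure hact1 -hd01 dOmega_hd -[1 : R]scale1r hdK //.
by rewrite mul0rn pure0l add0r tmapl_kahlerK.
Qed.
End OfConnection.

Section OfIterative.
Variables (N : hconn M) (N_iter : iterative N).

(** Iterativity concerns the completion, so [x] is placed there as the only component, in degree
    [a], and degree [a + j + i] is read off. *)
Lemma iterative_tdeg a i j x : tdeg a x ->
  ext_nabla N i (ext_nabla N j x) = ext_nabla N (i + j) x *+ 'C(i + j, i).
Proof.
move=> ax.
have uP k : tdeg k (if k == a then x else 0).
  by case: eqP => [->|_]; [exact: ax|exact: tdeg0].
have := N_iter i j (Completion uP) (a + j + i); rewrite /=.
have -> : (i <= a + j + i)%N by lia. have -> : (i + j <= a + j + i)%N by lia.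
have -> : (j <= a + j + i - i)%N by lia.
have -> : (a + j + i - i - j = a)%N by lia.
have -> : (a + j + i - (i + j) = a)%N by lia.
by rewrite eqxx.
Qed.

Lemma ext_nabla_pure1 n m : ext_nabla N n (pure 1 m) = N m n.
Proof.
rewrite ext_nabla_pure big_ord_recl big1 => [|i _].
  by rewrite dOmega_0 hact1 subn0 addr0.
by rewrite -hd01 dOmega_hd -[1 : R]scale1r hdK // mul0rn hact_l0.
Qed.

(** The pair [(n, 1)] keeps [nabla^(1)] innermost, the form needed for the differential equation of
    [nabla_psi]. *)
Lemma iterative_nablaS n m : ext_nabla N n (N m 1) = N m n.+1 *+ n.+1.
Proof.
rewrite -ext_nabla_pure1 (iterative_tdeg n 1 (tdeg_pure m (hdeg_gen 0 1))).
by rewrite ext_nabla_pure1 addn1 binSn.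
Qed.

(** Iterativity for the pair [(1, n)] at [1 (x) m] is the recursion of divided powers, so
    [nabla^(1)] determines [N]. *)
Lemma divpow_conn_of_hconn n m :
  divpow (conn_ext (conn_of_hconn N)) n (pure 1 m) = N m n.
Proof.
elim: n => [|n IHn]; first by rewrite nabla0.
apply: (torsion_free_inj tfT (n := n)).
rewrite (proj2 (divpow_expseq K_char0 _)) IHn -ext_nabla1 -ext_nabla_pure1.
rewrite (iterative_tdeg 1 n (tdeg_pure m (hdeg_gen 0 1))) bin1.
by rewrite ext_nabla_pure1 add1n.
Qed.
End OfIterative.
End CharacteristicZero.
End Module.

Lemma conn_ext_tmap (M N : lmodType R) (f : {linear M -> N})
    (c : conn M) (d : conn N) (x : tensor (hdiff R) M) :
    (forall m, d (f m) = tmap f (c m)) ->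
  conn_ext d (tmap f x) = tmap f (conn_ext c x).
Proof.
move=> fP; elim/tensor_ind: x => [v m||x y IHx IHy|x IHx].
- rewrite !(conn_ext_pure, tmap_pure, tmap_D) fP; congr (_ + _).
  rewrite tmapl_tmap; elim/tensor_ind: (tmapl _ _) => [w n||x y IHx IHy|x IHx].
  + by rewrite !(hact_pure, tmap_pure).
  + by rewrite !raddf0.
  + by rewrite !raddfD /= IHx IHy.
  + by rewrite !raddfN /= IHx.
- by rewrite !raddf0.
- by rewrite !raddfD /= IHx IHy.
- by rewrite !raddfN /= IHx.
Qed.

(** Commutation with [conn_ext] passes to divided powers, so morphisms of connections respect the
    associated higher connections. *)
Lemma divpow_tmap (K_char0 : [pchar K] =i pred0) (M N : lmodType R)
    (f : {linear M -> N}) (c : conn M) (d : conn N) n (x : tensor (hdiff R) M) :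
    (forall m, d (f m) = tmap f (c m)) ->
  divpow (conn_ext d) n (tmap f x) = tmap f (divpow (conn_ext c) n x).
Proof.
move=> fP; apply/esym/(@expseq_intertwine _ _ (tmap f) (conn_ext c) _ (conn_ext d)).
- exact: lmod_torsion_free.
- by move=> y z; rewrite raddfB.
- exact: divpow_expseq.
- exact: divpow_expseq.
- by move=> y; apply/esym/conn_ext_tmap.
Qed.
End ConnectionExtension.

(** * Integrability *)

Section Integrability.
Variables (K : fieldType) (R : comAlgType K) (K_char0 : [pchar K] =i pred0).

Lemma fpsm_mul_shift (a : R) i (f : fps R) n : (fpsm i a * f) (i + n)%N = a * f n.
Proof.
have lt_i : (i < (i + n).+1)%N by rewrite ltnS leq_addr.
rewrite fpsME (bigD1 (Ordinal lt_i)) //= {1}/fpsm eqxx addKn big1 ?addr0 //.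
by move=> j; rewrite -val_eqE /fpsm /= => /negPf ->; rewrite mul0r.
Qed.

Section CommutatorFamily.
Variables (psi : hder R) (D0 : kder R) (D X : nat -> kder R).
Hypotheses (psiD : euler (hder_coef psi) = conv (hder_coef psi) D)
  (D0X : (fun n r => D0 (hder_coef psi n r)) = conv (hder_coef psi) X).

Lemma euler_hder_0 r : D 0 r = 0.
Proof.
have := congr1 (fun F => F 0%N r) psiD.
by rewrite /euler /conv big_ord1 mulr0n hder_coef0.
Qed.

Lemma comp_hder_0 r : X 0 r = D0 r.
Proof.
by have := congr1 (fun F => F 0%N r) D0X; rewrite /conv big_ord1 !hder_coef0.
Qed.

(** Differentiating [D0 psi = psi X] gives [psi X D] on the left and [psi D X + psi (T dX/dT)] on
    the right; then [psi] is cancelled. *)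
Lemma comp_hder_euler : conv_add (euler X) (conv D X) = conv X D.
Proof.
have PA := @hder_coef_additive K R psi.
apply: (conv_cancel PA (hder_coef0 psi)).
rewrite conv_addr // !convA // -psiD -D0X.
transitivity (euler (conv (hder_coef psi) X)).
  rewrite euler_conv // /conv_add.
  by apply/funext => n; apply/funext => r; rewrite addrC.
rewrite -D0X; apply/funext => n; apply/funext => r.
rewrite /euler -raddfMn -[_ *+ n]/(euler (hder_coef psi) n r) psiD.
by rewrite raddf_sum.
Qed.
End CommutatorFamily.

(** * Covariant derivatives along series of derivations *)

Section NablaDer.
Variables (M : lmodType R) (c : conn M).

HB.instance Definition _ (D : kder R) :=
  GRing.Additive.on (contract D : tensor (kahler R) M -> M).

Lemma contract_pure (D : kder R) r (m : M) :
  contract D (pure (kd r) m) = D r *: m.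
Proof. by rewrite /contract tlift_pure klift_kd. Qed.

Lemma tensor_kahler_ind (P : tensor (kahler R) M -> Prop) :
    (forall r m, P (pure (kd r) m)) -> P 0 ->
    (forall x y, P x -> P y -> P (x + y)) -> (forall x, P x -> P (- x)) ->
  forall x, P x.
Proof.
move=> Ppure P0 Padd Popp; elim/tensor_ind => // v m.
elim/kahler_ind: v m => [r||v w Pv Pw|r v Pv] m //.
- by rewrite pure0l.
- by rewrite pureDl; auto.
- by rewrite pureZ; auto.
Qed.

Lemma nabla_der_additive (D : kder R) : zmod_morphism (nabla_der c D).
Proof.
by move=> m n; apply/eqP; rewrite eq_sym subr_eq -raddfD -connD subrK.
Qed.

(** Additivity of [D |-> nabla_D], in a form that needs no addition on [kder R]. On [kd r (x) n] the
    contraction is [D r *: n]. *)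
Lemma nabla_der_sum (s t : seq (kder R)) m :
    (forall r, \sum_(D <- s) D r = \sum_(D <- t) D r) ->
  \sum_(D <- s) nabla_der c D m = \sum_(D <- t) nabla_der c D m.
Proof.
move=> st; rewrite /nabla_der.
elim/tensor_kahler_ind: (c m) => [r n||x y IHx IHy|x IHx].
- under eq_bigr do rewrite contract_pure.
  under [RHS]eq_bigr do rewrite contract_pure.
  by rewrite -!scaler_suml st.
- by rewrite !big1 // => D _; rewrite raddf0.
- under eq_bigr do rewrite raddfD.
  under [RHS]eq_bigr do rewrite raddfD.
  by rewrite !big_split /= IHx IHy.
- under eq_bigr do rewrite raddfN.
  under [RHS]eq_bigr do rewrite raddfN.
  by rewrite !sumrN IHx.
Qed.

Lemma nabla_der_eq (D E : kder R) m : D =1 E -> nabla_der c D m = nabla_der c E m.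
Proof.
move=> DE; have := @nabla_der_sum [:: D] [:: E] m; rewrite !big_seq1; apply.
by move=> r; rewrite !big_seq1.
Qed.

Lemma nabla_der_eq0 (D : kder R) m : (forall r, D r = 0) -> nabla_der c D m = 0.
Proof.
move=> D0; have := @nabla_der_sum [:: D] [::] m; rewrite big_seq1 big_nil; apply.
by move=> r; rewrite big_seq1 big_nil.
Qed.

Definition nabla_ders (D : nat -> kder R) : nat -> M -> M :=
  fun n => nabla_der c (D n).

Lemma nabla_ders_additive D n : zmod_morphism (nabla_ders D n).
Proof. exact: nabla_der_additive. Qed.

(** The hypothesis says that [n X_n] is the sum of the brackets [[X_(n-i), D_i]]. Additivity and
    integrability carry this over to [nabla], comparing [n] copies of [X n] with the list of
    brackets. *)
Lemma nabla_ders_commutator (D X : nat -> kder R) :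
    integrable c -> conv_add (euler X) (conv D X) = conv X D ->
  conv_add (euler (nabla_ders X)) (conv (nabla_ders D) (nabla_ders X)) =
  conv (nabla_ders X) (nabla_ders D).
Proof.
move=> c_int DX; apply/funext => n; apply/funext => m.
pose s := [seq kder_bracket (X (n - i)%N) (D i) | i <- index_iota 0 n.+1].
have sE r : \sum_(E <- s) E r = \sum_(E <- nseq n (X n)) E r.
  have /(congr1 (fun F => F n r)) := DX; rewrite /conv_add /euler convE /conv.
  rewrite big_nseq iter_addr_0 => DXn.
  by rewrite big_map big_mkord sumrB -DXn addrK.
have := nabla_der_sum m sE.
rewrite big_map big_mkord big_nseq iter_addr_0.
under eq_bigr do rewrite -c_int.
rewrite sumrB /conv_add convE => /eqP; rewrite subr_eq => /eqP <-.
by [].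
Qed.
End NablaDer.

(** * The differential equation of [nabla_psi] *)

Section Iterative.
Variables (M : lmodType R) (N : hconn M) (N_iter : iterative N).
Let c := conn_of_hconn N.
Let tfM : torsion_free M := lmod_torsion_free K_char0 (V := M).

Definition nabla_coef (psi : hder R) : nat -> M -> M :=
  fun n m => nabla_psi N psi m n.

Lemma nabla_coef_additive psi n : zmod_morphism (nabla_coef psi n).
Proof.
move=> x y; apply/eqP; rewrite eq_sym subr_eq.
by rewrite /nabla_coef /nabla_psi /tildeM -raddfD -nablaD subrK.
Qed.

Lemma nabla_coef0 psi m : nabla_coef psi 0 m = m.
Proof.
rewrite /nabla_coef /nabla_psi /tildeM nabla0 tlift_pure.
by rewrite -hd01 tilde_hd hder0 /fpsm scale1r.
Qed.

Lemma tildeM_hact psi i n (r : R) (x : tensor (hdiff R) M) :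
  tlift (tildeM_balanced M psi (i + n)) (hact (hd i r) x) =
  psi r i *: tlift (tildeM_balanced M psi n) x.
Proof.
elim/tensor_ind: x => [v m||x y IHx IHy|x IHx].
- rewrite hact_pure !tlift_pure rmorphM /= tilde_hd scalerA.
  by congr (_ *: _); apply: fpsm_mul_shift.
- by rewrite !raddf0.
- by rewrite !raddfD /= IHx IHy.
- by rewrite !raddfN /= IHx.
Qed.

Lemma nabla_coefZ psi n r m :
  nabla_coef psi n (r *: m) = \sum_(i < n.+1) psi r i *: nabla_coef psi (n - i) m.
Proof.
rewrite /nabla_coef /nabla_psi /tildeM nablaZ /= raddf_sum.
apply: eq_bigr => i _; rewrite -tildeM_hact subnKC // -ltnS //.
Qed.

(** The coefficient [(n + 1) nabla^(n+1)] is the extension of [nabla] applied to [nabla^(1)]. On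
    [d^(1) r] the extension produces [(i + 1) d^(i+1) r], and the equation of [psi] evaluates
    this. *)
Lemma euler_nabla psi (D : nat -> kder R) :
    euler (hder_coef psi) = conv (hder_coef psi) D ->
  euler (nabla_coef psi) = conv (nabla_coef psi) (nabla_ders c D).
Proof.
move=> psiD; apply/funext => -[|n]; apply/funext => m.
  rewrite /euler /conv big_ord1 mulr0n nabla_coef0 [RHS]nabla_der_eq0 //.
  exact: euler_hder_0 psiD.
have -> : euler (nabla_coef psi) n.+1 m =
    tlift (tildeM_balanced M psi n.+1) (ext_nabla N n (N m 1)).
  by rewrite iterative_nablaS // raddfMn.
rewrite -(tdeg1_kahlerK (coefsP (N m) 1)) /conv /nabla_ders /nabla_der.
(* The claim is additive in [y], so with [nabla^(1) m] generalised it can be checked on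
   [kd r (x) m]. *)
have : forall y : tensor (kahler R) M,
    tlift (tildeM_balanced M psi n.+1) (ext_nabla N n (tmapl (kahler_hd R) y)) =
    \sum_(i < n.+2) nabla_coef psi (n.+1 - i) (contract (D i) y); last by apply.
move=> {m}; elim/tensor_kahler_ind => [r m||x y IHx IHy|x IHx].
- pose F j i k := psi (D j r) i *: nabla_coef psi k m.
  transitivity (\sum_(j < n.+2) \sum_(i < (n.+1 - j).+1) F j i (n.+1 - j - i)%N).
    rewrite -sum_triangle big_ord_recl big_ord1 /F.
    (* The first outer term contains [D 0 r = 0]; dropping it shifts the index to that of
       [d^(i+1) r]. *)
    rewrite (euler_hder_0 psiD) rmorph0 fps0E scale0r add0r.
    rewrite tmapl_pure kahler_hd_kd ext_nabla_pure raddf_sum.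
    apply: eq_bigr => i _; rewrite -scaler_suml.
    have /(congr1 (fun G => G i.+1 r)) := psiD; rewrite /euler /conv /= => <-.
    case: i => i /= lt_i; have nE : n.+1 = (1 + i + (n - i))%N by lia.
    rewrite dOmega_hd (additiveMn (hact_additivel _)) raddfMn /= [in LHS]nE.
    rewrite tildeM_hact scalerMnl add1n binSn.
    by rewrite subSS.
  by apply: eq_bigr => j _; rewrite contract_pure nabla_coefZ.
- rewrite !raddf0 big1 // => j _.
  by rewrite raddf0 (additive0 (nabla_coef_additive _ _)).
- rewrite !raddfD /= IHx IHy -big_split; apply: eq_bigr => j _.
  by rewrite raddfD (additiveD (nabla_coef_additive _ _)).
- rewrite !raddfN /= IHx -sumrN; apply: eq_bigr => j _.
  by rewrite raddfN (additiveN (nabla_coef_additive _ _)).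
Qed.

Lemma euler_coef12 (V : zmodType) (P E : nat -> V -> V) x :
    (forall n, zmod_morphism (P n)) -> (forall x, P 0 x = x) ->
    (forall x, E 0 x = 0) -> euler P = conv P E ->
  P 1%N x = E 1%N x /\ P 2%N x *+ 2 = E 1%N (E 1%N x) + E 2%N x.
Proof.
move=> PA P0 E0 eP.
have P1 y : P 1%N y = E 1%N y.
  have /(congr1 (fun F => F 1%N y)) := eP.
  by rewrite conv_vanish // big_ord1 P0 /euler mulr1n.
split=> //; have /(congr1 (fun F => F 2%N x)) := eP.
by rewrite conv_vanish // big_ord_recl big_ord1 /= P0 P1.
Qed.

(** The product of the two series must be shown to solve the equation for [psi1 psi2]; its
    right-hand side is first computed on [R], then lifted to [M]. *)
Lemma hintegrable_of_integrable : integrable c -> hintegrable N.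
Proof.
move=> c_int psi1 psi2 m; set psi := hder_comp psi1 psi2.
suff nE : nabla_coef psi = conv (nabla_coef psi1) (nabla_coef psi2).
  by apply/funext => n; rewrite -[LHS]/(nabla_coef psi n m) nE.
have [D1 D1E] := euler_hder psi1; have [D2 D2E] := euler_hder psi2.
have [D DE] := euler_hder psi.
have [X XE] := choice (fun b => comp_hder (D1 b) psi2).
(* Multiplied by [psi] on the left, both sides become [euler (hder_coef psi)]. *)
have DX : (fun n => D n : R -> R) =
    conv_add (fun l r => \sum_(b < l.+1) X b (l - b)%N r) D2.
  apply: (conv_cancel (hder_coef_additive psi) (hder_coef0 psi)).
  rewrite -DE conv_hder_comp.
  by apply: (euler_conv_conv _ _ D1E D2E XE); apply: hder_coef_additive.
(* The relation [D1_b psi2 = psi2 X_b] holds on [M] as well; this is where integrability of [c]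
   enters. *)
have nX b : (fun n m => nabla_der c (D1 b) (nabla_coef psi2 n m)) =
    conv (nabla_coef psi2) (nabla_ders c (X b)).
  apply: (comp_conv tfM (D := nabla_ders c D2)).
  - exact: nabla_der_additive.
  - exact: nabla_coef_additive.
  - exact: nabla_ders_additive.
  - exact: nabla_coef0.
  - by move=> x; apply/nabla_der_eq/(comp_hder_0 (XE b)).
  - by move=> x; apply/nabla_der_eq0/(euler_hder_0 D2E).
  - exact: euler_nabla.
  - exact/nabla_ders_commutator/(comp_hder_euler D2E (XE b)).
have nDX : nabla_ders c D = conv_add
    (fun l x => \sum_(b < l.+1) nabla_ders c (X b) (l - b)%N x) (nabla_ders c D2).
  apply/funext => l; apply/funext => x.
  pose s := rcons [seq X b (l - b)%N | b <- index_iota 0 l.+1] (D2 l).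
  have sE r : \sum_(E <- [:: D l]) E r = \sum_(E <- s) E r.
    have /(congr1 (fun F => F l r)) := DX; rewrite /conv_add big_seq1 => ->.
    by rewrite /s -cats1 big_cat big_seq1 big_map big_mkord.
  have := nabla_der_sum c x sE.
  by rewrite big_seq1 /s -cats1 big_cat big_seq1 big_map big_mkord.
have nA := nabla_coef_additive.
apply: (euler_uniq tfM (D := nabla_ders c D)).
- exact: nA.
- exact: conv_additive.
- by move=> x; rewrite /conv big_ord1 !nabla_coef0.
- by move=> x; apply/nabla_der_eq0/(euler_hder_0 DE).
- exact: euler_nabla.
- rewrite nDX.
  exact: (euler_conv_conv (nA _) (nA _) (euler_nabla D1E) (euler_nabla D2E) nX).
Qed.

(** Read [a, b, d, e] as [D1^2, D1 D2, D2^2, D2 D1]: twice the coefficient of [T^2] in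
    [exp (D1 T) exp (D2 T)] equals [(D1 + D2)^2] plus the coefficient [x] of the logarithmic
    derivative. *)
Lemma commutator_of_squares (V : zmodType) (a b d e x : V) :
  a + (b *+ 2 + d) = a + b + (e + d) + x -> x = b - e.
Proof.
rewrite mulr2n !addrA (addrAC _ b d) [a + b + e + d]addrAC -(addrA _ e).
by move/addrI->; rewrite addrAC subrr add0r.
Qed.

(** The coefficients of [T^2] for [exp(D1 T) exp(D2 T)]. *)
Lemma integrable_of_hintegrable : hintegrable N -> integrable c.
Proof.
move=> N_int D1 D2 m.
have [psi1 [_ psi1S]] := kder_exp K_char0 D1.
have [psi2 [_ psi2S]] := kder_exp K_char0 D2.
have [E1 E1E] := euler_hder psi1; have [E2 E2E] := euler_hder psi2.
pose psi := hder_comp psi1 psi2; have [E EE] := euler_hder psi.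
have R12 (p : hder R) (F : nat -> kder R) r
    (FE : euler (hder_coef p) = conv (hder_coef p) F) :=
  euler_coef12 r (hder_coef_additive p) (hder_coef0 p) (euler_hder_0 FE) FE.
have M12 (p : hder R) (F : nat -> kder R) x
    (FE : euler (hder_coef p) = conv (hder_coef p) F) :=
  euler_coef12 x (nabla_coef_additive p) (nabla_coef0 p)
    (fun y => nabla_der_eq0 c y (euler_hder_0 FE)) (euler_nabla FE).
have exp1 p (D : kder R) r :
    (forall n x, hder_coef p n.+1 x *+ n.+1 = D (hder_coef p n x)) ->
    hder_coef p 1%N r = D r.
  by move=> pS; rewrite -[LHS]mulr1n pS hder_coef0.
(* The logarithmic derivative of [exp (D T)] is [D T], so its coefficients at [T] and [T^2] are [D]
   and [0]. *)
have exp2 p (D : kder R) (F : nat -> kder R) r :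
    (forall n x, hder_coef p n.+1 x *+ n.+1 = D (hder_coef p n x)) ->
    euler (hder_coef p) = conv (hder_coef p) F -> F 1%N r = D r /\ F 2%N r = 0.
  move=> pS FE; have F1 x : F 1%N x = D x.
    by rewrite -(proj1 (R12 p F x FE)) (exp1 p D x pS).
  split=> //; have [_] := R12 p F r FE; rewrite pS (exp1 p D r pS) !F1.
  by move/eqP; rewrite addrC -subr_eq subrr eq_sym => /eqP.
have E_1 r : E 1%N r = D1 r + D2 r.
  rewrite -(proj1 (R12 psi E r EE)) conv_hder_comp /conv big_ord_recl big_ord1 /=.
  by rewrite !hder_coef0 (exp1 _ _ _ psi1S) (exp1 _ _ _ psi2S).
have E_2 r : E 2%N r = kder_bracket D1 D2 r.
  have [_] := R12 psi E r EE; rewrite !E_1 !raddfD /=.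
  rewrite conv_hder_comp /conv !big_ord_recl big_ord0 /= !mulrnDl !hder_coef0.
  rewrite psi1S psi2S !(exp1 _ _ _ psi1S) !(exp1 _ _ _ psi2S).
  by rewrite mul0rn addr0 => /commutator_of_squares.
have nE2 : nabla_der c (E 2%N) m = nabla_der c (kder_bracket D1 D2) m.
  exact: nabla_der_eq.
have nE1 x : nabla_ders c E 1 x = nabla_der c D1 x + nabla_der c D2 x.
  have := @nabla_der_sum M c [:: E 1%N] [:: D1; D2] x.
  rewrite !(big_seq1, big_cons, big_nil) addr0; apply => r.
  by rewrite !(big_seq1, big_cons, big_nil) addr0.
have nF p (D : kder R) (F : nat -> kder R) x
    (pS : forall n x, hder_coef p n.+1 x *+ n.+1 = D (hder_coef p n x))
    (FE : euler (hder_coef p) = conv (hder_coef p) F) :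
    nabla_coef p 1 x = nabla_der c D x /\
    nabla_coef p 2 x *+ 2 = nabla_der c D (nabla_der c D x).
  have F1 y : nabla_ders c F 1 y = nabla_der c D y.
    by apply: nabla_der_eq => r; have [] := exp2 p D F r pS FE.
  have [-> ->] := M12 p F x FE; split; first exact: F1.
  rewrite !F1 [X in _ + X]nabla_der_eq0 ?addr0 // => r.
  by have [] := exp2 p D F r pS FE.
(* The same comparison on [M], where [x] is already known to be [nabla_[D1, D2]]. *)
have [_] := M12 psi E m EE.
have -> : nabla_coef psi 2 m = conv (nabla_coef psi1) (nabla_coef psi2) 2 m.
  by rewrite /nabla_coef N_int.
rewrite /conv !big_ord_recl big_ord0 /= !mulrnDl !nabla_coef0 mul0rn addr0.
rewrite (proj2 (nF _ _ _ _ psi1S E1E)) (proj2 (nF _ _ _ _ psi2S E2E)).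
rewrite (proj1 (nF _ _ _ _ psi1S E1E)) (proj1 (nF _ _ _ _ psi2S E2E)).
rewrite !nE1 !(additiveD (nabla_der_additive _ _)) [nabla_ders c E 2 m]nE2.
by move/commutator_of_squares->.
Qed.
End Iterative.
End Integrability.

(** * Equivalences of full subcategories *)

Section FullSubcategories.
Variables (C D : category) (F : functor C D) (G : functor D C) (P : C -> Prop).

Program Definition functor_to_full (GP : forall B, P (G B)) :
    functor D (full_subcategory P) :=
  @Functor D (full_subcategory P) (fun B => exist P (G B) (GP B))
    (fun A B f => fmap G f) _ _.
Next Obligation. exact: fmap_id. Qed.
Next Obligation. exact: fmap_comp. Qed.

Program Definition functor_from_full : functor (full_subcategory P) D :=
  @Functor (full_subcategory P) D (fun A => F (sval A)) (fun A B f => fmap F f) _ _.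
Next Obligation. exact: fmap_id. Qed.
Next Obligation. exact: fmap_comp. Qed.

Program Definition functor_full (Q : D -> Prop) (FQ : forall A, P A -> Q (F A)) :
    functor (full_subcategory P) (full_subcategory Q) :=
  @Functor (full_subcategory P) (full_subcategory Q)
    (fun A => exist Q (F (sval A)) (FQ _ (svalP A))) (fun A B f => fmap F f) _ _.
Next Obligation. exact: fmap_id. Qed.
Next Obligation. exact: fmap_comp. Qed.
End FullSubcategories.

Section FullEquivalence.
Variables (C D : category) (F : functor C D) (G : functor D C) (P : C -> Prop).
Variable eta : nat_iso (comp_functor F G) (id_functor D).
Variables (e : forall A, P A -> Defs.Hom (G (F A)) A)
  (e' : forall A, P A -> Defs.Hom A (G (F A))).
Hypotheses (eK : forall A (PA : P A), comp_hom (e' PA) (e PA) = id_hom (G (F A)))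
  (e'K : forall A (PA : P A), comp_hom (e PA) (e' PA) = id_hom A)
  (e_nat : forall A B (PA : P A) (PB : P B) (f : Defs.Hom A B),
    comp_hom (e PB) (fmap G (fmap F f)) = comp_hom f (e PA)).

(** The isomorphisms [e] exist only on objects satisfying [P], so the equivalence appears after
    restriction. *)
Lemma equivalent_full (Q : D -> Prop) :
    (forall A, P A -> Q (F A)) -> (forall B, Q B -> P (G B)) ->
  equivalent (full_subcategory P) (full_subcategory Q).
Proof.
move=> FQ GP; exists (functor_full FQ), (functor_full GP); split; constructor.
- exact: (@NatIso (full_subcategory P) (full_subcategory P)
    (comp_functor (functor_full GP) (functor_full FQ)) (id_functor _)
    (fun A => e (svalP A)) (fun A => e' (svalP A))
    (fun A => eK (svalP A)) (fun A => e'K (svalP A))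
    (fun A B f => e_nat (svalP A) (svalP B) f)).
- exact: (@NatIso (full_subcategory Q) (full_subcategory Q)
    (comp_functor (functor_full FQ) (functor_full GP)) (id_functor _)
    (fun B => ni_to eta (sval B)) (fun B => ni_from eta (sval B))
    (fun B => ni_toK eta (sval B)) (fun B => ni_fromK eta (sval B))
    (fun A B f => ni_natural eta f)).
Qed.

Lemma equivalent_full_left :
  (forall B, P (G B)) -> equivalent (full_subcategory P) D.
Proof.
move=> GP; exists (functor_from_full F P), (functor_to_full GP).
split; constructor; last first.
  exact: (@NatIso D D
    (comp_functor (functor_from_full F P) (functor_to_full GP)) (id_functor _)
    (ni_to eta) (ni_from eta) (ni_toK eta) (ni_fromK eta)
    (fun A B f => ni_natural eta f)).
exact: (@NatIso (full_subcategory P) (full_subcategory P)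
    (comp_functor (functor_to_full GP) (functor_from_full F P)) (id_functor _)
    (fun A => e (svalP A)) (fun A => e' (svalP A))
    (fun A => eK (svalP A)) (fun A => e'K (svalP A))
    (fun A B f => e_nat (svalP A) (svalP B) f)).
Qed.
End FullEquivalence.

(** * The functors between the categories of connections *)

Section ConnectionFunctors.
Variables (K : fieldType) (R : comAlgType K) (K_char0 : [pchar K] =i pred0).

Definition conn_module_of (A : hconn_module R) : conn_module R :=
  ConnModule (hcm_fg A) (conn_of_hconn (hcm_nabla A)).

Definition hconn_module_of (B : conn_module R) : hconn_module R :=
  HConnModule (cm_fg B) (hconn_of_conn K_char0 (cm_nabla B)).

Section Homs.
Variables (A A' : hconn_module R) (f : hconn_hom A A').

Lemma conn_hom_of_subproof m :
  conn_of_hconn (hcm_nabla A') (f m) = tmap f (conn_of_hconn (hcm_nabla A) m).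
Proof. by rewrite /= /conn_of_hconn_fun hconn_funP tmapl_tmap. Qed.

Definition conn_hom_of : conn_hom (conn_module_of A) (conn_module_of A') :=
  @ConnHom K R (conn_module_of A) (conn_module_of A') f conn_hom_of_subproof.
End Homs.

Section Homs.
Variables (B B' : conn_module R) (f : conn_hom B B').

Lemma hconn_hom_of_subproof m k :
  hconn_of_conn K_char0 (cm_nabla B') (f m) k =
  tmap f (hconn_of_conn K_char0 (cm_nabla B) m k).
Proof.
have := divpow_tmap K_char0 k (pure 1 m) (conn_hom_funP f).
by rewrite tmap_pure.
Qed.

Definition hconn_hom_of : hconn_hom (hconn_module_of B) (hconn_module_of B') :=
  @HConnHom K R (hconn_module_of B) (hconn_module_of B') f hconn_hom_of_subproof.
End Homs.

Program Definition conn_functor : functor (HCon R) (Con R) :=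
  @Functor (HCon R) (Con R) conn_module_of conn_hom_of _ _.
Next Obligation. exact: conn_hom_eq. Qed.
Next Obligation. exact: conn_hom_eq. Qed.

Program Definition hconn_functor : functor (Con R) (HCon R) :=
  @Functor (Con R) (HCon R) hconn_module_of hconn_hom_of _ _.
Next Obligation. exact: hconn_hom_eq. Qed.
Next Obligation. exact: hconn_hom_eq. Qed.

Lemma conn_counit_subproof (B : conn_module R) m :
  cm_nabla B (idfun m) =
  tmap (idfun : {linear B -> B})
    (conn_of_hconn (hconn_of_conn K_char0 (cm_nabla B)) m).
Proof. by rewrite tmap_id conn_of_hconn_of_conn. Qed.

Lemma conn_counit_inv_subproof (B : conn_module R) m :
  conn_of_hconn (hconn_of_conn K_char0 (cm_nabla B)) (idfun m) =
  tmap (idfun : {linear B -> B}) (cm_nabla B m).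
Proof. by rewrite tmap_id conn_of_hconn_of_conn. Qed.

Program Definition conn_counit :
    nat_iso (comp_functor conn_functor hconn_functor) (id_functor (Con R)) :=
  @NatIso (Con R) (Con R)
    (comp_functor conn_functor hconn_functor) (id_functor (Con R))
    (fun B => @ConnHom K R (conn_module_of (hconn_module_of B)) B idfun
      (@conn_counit_subproof B))
    (fun B => @ConnHom K R B (conn_module_of (hconn_module_of B)) idfun
      (@conn_counit_inv_subproof B)) _ _ _.
Next Obligation. exact: conn_hom_eq. Qed.
Next Obligation. exact: conn_hom_eq. Qed.
Next Obligation. exact: conn_hom_eq. Qed.

Section Unit.
Variables (A : hconn_module R) (A_iter : iterative (hcm_nabla A)).

Lemma hconn_unit_subproof m k :
  hcm_nabla A (idfun m) k = tmap (idfun : {linear A -> A})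
    (hconn_of_conn K_char0 (conn_of_hconn (hcm_nabla A)) m k).
Proof. by rewrite tmap_id; apply/esym/divpow_conn_of_hconn. Qed.

Lemma hconn_unit_inv_subproof m k :
  hconn_of_conn K_char0 (conn_of_hconn (hcm_nabla A)) (idfun m) k =
  tmap (idfun : {linear A -> A}) (hcm_nabla A m k).
Proof. by rewrite tmap_id; apply: divpow_conn_of_hconn. Qed.

Definition hconn_unit : hconn_hom (hconn_module_of (conn_module_of A)) A :=
  @HConnHom K R (hconn_module_of (conn_module_of A)) A idfun hconn_unit_subproof.

Definition hconn_unit_inv : hconn_hom A (hconn_module_of (conn_module_of A)) :=
  @HConnHom K R A (hconn_module_of (conn_module_of A)) idfun
    hconn_unit_inv_subproof.
End Unit.

(** Transports integrability to the connection recovered from [hconn_of_conn], which is known to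
    agree pointwise with the original. *)
Lemma integrable_eq (M : lmodType R) (c d : conn M) :
  c =1 d -> integrable c -> integrable d.
Proof.
move=> cd c_int D1 D2 m; have := c_int D1 D2 m.
by rewrite /nabla_der !cd.
Qed.

End ConnectionFunctors.

Theorem theorem7p2 (K : fieldType) (R : comAlgType K)
    (K_char0 : [pchar K] =i pred0)
    (R_domain : GRing.integral_domain_axiom R)
    (R_regular : regular_ring R)
    (R_loc : essentially_of_finite_type R)
    (R_max : has_finite_residue_field R) :
  equivalent (ICon R) (Con R) /\ equivalent (ICon_int R) (Con_int R).
Proof.
split.
  (* Every ordinary connection has an iterative extension, so only the higher side is restricted. *)
  apply: (@equivalent_full_left _ _ (conn_functor R) (hconn_functor R K_char0)
    (fun A : HCon R => iterative (hcm_nabla A)) (conn_counit R K_char0)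
    (hconn_unit K_char0) (hconn_unit_inv K_char0)).
  - by move=> A A_iter; apply: hconn_hom_eq.
  - by move=> A A_iter; apply: hconn_hom_eq.
  - by move=> A B A_iter B_iter f; apply: hconn_hom_eq.
  - by move=> B; apply: hconn_of_conn_iterative.
apply: (@equivalent_full _ _ (conn_functor R) (hconn_functor R K_char0)
  (fun A : HCon R => iterative (hcm_nabla A) /\ hintegrable (hcm_nabla A))
  (conn_counit R K_char0) (fun A PA => hconn_unit K_char0 (proj1 PA))
  (fun A PA => hconn_unit_inv K_char0 (proj1 PA))).
- by move=> A A_iter; apply: hconn_hom_eq.
- by move=> A A_iter; apply: hconn_hom_eq.
- by move=> A B A_iter B_iter f; apply: hconn_hom_eq.
- move=> A [A_iter A_int]; exact: integrable_of_hintegrable.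
- move=> B B_int; have B_iter := hconn_of_conn_iterative K_char0 (cm_nabla B).
  split=> //; apply: (hintegrable_of_integrable K_char0 B_iter).
  by apply: integrable_eq B_int => m; rewrite conn_of_hconn_of_conn.
Qed.
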